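(* Let $H$ be a separable infinite-dimensional complex Hilbert space. For every bounded operator $T$ on $H$ there exist complex numbers $c_1,\dots,c_8$ and orthoprojections $P_1,\dots,P_8$ on $H$ such that $T=\sum_{i=1}^{8}c_iP_i$.
   Context: An orthoprojection on $H$ is a bounded operator $P$ on $H$ with $P=P^*=P^2$. *)

(* Defs.v *)
From HB Require Import structures.
From mathcomp Require Import all_boot all_order all_algebra.
From mathcomp Require Import complex.
From mathcomp Require Import boolp classical_sets cardinality reals topology normedtype.
Set Implicit Arguments.
Unset Strict Implicit.
Unset Printing Implicit Defensive.
Import Order.TTheory GRing.Theory Num.Theory.
Import numFieldNormedType.Exports.
Local Open Scope classical_set_scope.
Local Open Scope ring_scope.

(* A complex Hilbert space is a complete normed module [H] over [R[i]] together
   with an inner product [dot : {dot H for Num.conj}] (linear in the first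
   argument, conjugate-linear in the second) that induces the norm of [H]. *)
Definition induces_norm (R : realType) (H : normedModType R[i])
    (dot : {dot H for Num.conj}) : Prop :=
  forall x : H, `|x| ^+ 2 = dot x x.

Definition separable (T : topologicalType) : Prop :=
  exists2 S : set T, countable S & dense S.

Definition finite_dimensional (K : fieldType) (V : lmodType K) : Prop :=
  exists (n : nat) (v : 'I_n -> V),
    forall x : V, exists a : 'I_n -> K, x = \sum_(i < n) a i *: v i.

Definition infinite_dimensional (K : fieldType) (V : lmodType K) : Prop :=
  ~ finite_dimensional V.

Definition bounded_operator (K : numFieldType) (V : normedModType K)
    (T : {linear V -> V}) : Prop :=
  exists M : K, forall x : V, `|T x| <= M * `|x|.

Lemma bounded_operatorP (K : numFieldType) (V : normedModType K)
    (T : {linear V -> V}) :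
  bounded_operator T <-> bounded_near T (nbhs (0 : V)).
Proof.
split=> [[M TM]|/linear_boundedP/pinfty_ex_gt0[M _ TM]]; last by exists M.
apply/bounded_funP => r; exists (`|M| * `|r|) => x xr.
have MxE : M * `|x| = `|M * `|x| | by rewrite ger0_norm// (le_trans _ (TM x)).
rewrite (le_trans (TM x))// MxE normrM normr_id ler_wpM2l//.
by rewrite ger0_norm// (le_trans _ xr).
Qed.

(* [S] is the adjoint of [T]; in particular [adjoint_of dot P P] is [P = P^*]. *)
Definition adjoint_of (R : realType) (H : normedModType R[i])
    (dot : {dot H for Num.conj}) (T S : {linear H -> H}) : Prop :=
  forall x y : H, dot (T x) y = dot x (S y).

Definition orthoprojection (R : realType) (H : normedModType R[i])
    (dot : {dot H for Num.conj}) (P : {linear H -> H}) : Prop :=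
  [/\ bounded_operator P, adjoint_of dot P P & forall x : H, P (P x) = P x].

(* Main.v *)
Require Import Defs.
From HB Require Import structures.
From mathcomp Require Import all_boot all_order all_algebra.
From mathcomp Require Import complex.
From mathcomp Require Import boolp classical_sets functions cardinality.
From mathcomp Require Import reals topology normedtype.
From mathcomp Require Import ring lra zify.
Set Implicit Arguments.
Unset Strict Implicit.
Unset Printing Implicit Defensive.
Import Order.TTheory GRing.Theory Num.Theory.
Import numFieldNormedType.Exports.
Local Open Scope ring_scope.
Local Open Scope complex_scope.

(** The operator T is A + i B with A and B self-adjoint, so it suffices to
    write every self-adjoint A as a real combination of four projections.

    A pair of projections. Let X be self-adjoint and anticommute with a
    symmetry J (J self-adjoint, J^2 = 1). In the eigenspaces of J, X is an
    off-diagonal 2 x 2 block matrix, and an explicit matrix computation shows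
    that ep + X = a P + b Q for projections P and Q, provided that ep = 0 or that
    X is bounded below by a large multiple of |ep| ([two_projections]). So it
    is enough to find a real lam with A - lam = X1 + X2, where each Xi
    anticommutes with a symmetry Ji and X1 is bounded below by a large multiple
    of |lam|.

    Splitting A - lam. Take for lam a point of the essential spectrum of A,
    so that A' = A - lam is as small as one likes on unit vectors orthogonal to
    any prescribed finite set ([approximate_eigenvalue]). This yields an
    orthonormal basis whose index set splits into G and its complement, A'
    being small, in a summable way, on the basis vectors outside G
    ([adapted_basis]). The basis is arranged in levels indexed by the integers,
    with G as one level, and J1, J2 are the permutation operators that match
    the levels in the two possible ways along the integer line
    ([dihedral_index]). Then U = J2 J1 shifts the levels by two in one direction
    or the other, so the iterates of U carry G to orthogonal subspaces and the
    series B = sum_n U^n A' U^-n converges ([telescope]): the G-part of A' is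
    spread over orthogonal subspaces, the remainder is summable. By
    construction B - U B U^-1 = A', and a line of algebra shows that
    X1 = B - J1 B J1 and X2 = A' - X1 anticommute with J1 and J2.

    Bounding X1 below. The parity of the level defines a symmetry Z that
    anticommutes with both J1 and J2. Replacing X1 by X1 + c Z and X2 by
    X2 - c Z with c large keeps the anticommutation and makes X1 invertible
    with a large lower bound ([selfadjoint_four_projections]). *)

(** * Real-valued norms and limits of sequences *)
Section RealNorm.
Variables (R : realType) (V : normedZmodType R[i]).
Implicit Types x y : V.

(** Norms over [R[i]] take their values in [R[i]]; the real part is the same
    number in [R], where linear and nonlinear real arithmetic applies. *)
Definition nrm x : R := complex.Re `|x|.

Lemma nrmE x : `|x| = (nrm x)%:C.
Proof. by rewrite /nrm RRe_real// ger0_real. Qed.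

Lemma nrm_ge0 x : 0 <= nrm x.
Proof. by rewrite -ler0c -nrmE. Qed.

Lemma nrm0 : nrm (0 : V) = 0.
Proof. by rewrite /nrm normr0. Qed.

Lemma nrm0_eq0 x : nrm x = 0 -> x = 0.
Proof. by move=> x0; apply/eqP; rewrite -normr_eq0 nrmE x0. Qed.

Lemma nrm_gt0 x : x <> 0 -> 0 < nrm x.
Proof.
by move=> x0; rewrite lt_def nrm_ge0 andbT; apply/eqP => /nrm0_eq0.
Qed.

Lemma nrmN x : nrm (- x) = nrm x.
Proof. by rewrite /nrm normrN. Qed.

Lemma nrm_distC x y : nrm (x - y) = nrm (y - x).
Proof. by rewrite -nrmN opprB. Qed.

Lemma ler_nrmD x y : nrm (x + y) <= nrm x + nrm y.
Proof. by rewrite -lecR rmorphD/= -!nrmE ler_normD. Qed.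

Lemma ler_nrmB x y : nrm (x - y) <= nrm x + nrm y.
Proof. by rewrite (le_trans (ler_nrmD _ _))// nrmN. Qed.

Lemma ler_nrm_dist x y : nrm x <= nrm (x - y) + nrm y.
Proof. by rewrite -{1}(subrK y x) ler_nrmD. Qed.

Lemma ler_nrm_sum (I : Type) (r : seq I) (P : pred I) (F : I -> V) :
  nrm (\sum_(i <- r | P i) F i) <= \sum_(i <- r | P i) nrm (F i).
Proof.
elim/big_rec2: _ => [|i y1 y2 _ le12]; first by rewrite nrm0.
by rewrite (le_trans (ler_nrmD _ _))// lerD2l.
Qed.

Definition lim_to (v : nat -> V) (l : V) :=
  forall e : R, 0 < e -> exists N, forall n, (N <= n)%N -> nrm (v n - l) <= e.

Lemma lim_to_cst x : lim_to (fun=> x) x.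
Proof. by move=> e e0; exists 0%N => n _; rewrite subrr nrm0 ltW. Qed.

Lemma lim_to_ev N v w l : (forall n, (N <= n)%N -> v n = w n) ->
  lim_to v l -> lim_to w l.
Proof.
move=> vw vl e e0; have [M lM] := vl e e0; exists (maxn N M) => n.
by rewrite geq_max => /andP[Nn Mn]; rewrite -vw// lM.
Qed.

Lemma lim_to_ext v w l : v =1 w -> lim_to v l -> lim_to w l.
Proof. by move=> vw; apply: (@lim_to_ev 0%N). Qed.

Lemma lim_to_uniq v l1 l2 : lim_to v l1 -> lim_to v l2 -> l1 = l2.
Proof.
move=> v1 v2; apply/eqP; rewrite -subr_eq0; apply/eqP/nrm0_eq0/eqP.
rewrite eq_le nrm_ge0 andbT; apply/ler_addgt0Pl => e e0; rewrite addr0.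
have [|N hN] := v1 (e / 2); first by rewrite divr_gt0.
have [|M hM] := v2 (e / 2); first by rewrite divr_gt0.
have := hN _ (leq_maxl N M); have := hM _ (leq_maxr N M).
set w := v _ => h2 h1; have -> : l1 - l2 = (w - l2) - (w - l1).
  by rewrite opprB addrCA addrC -addrA addrC (addrC _ l1) subrKA addrC.
by rewrite (le_trans (ler_nrmB _ _))//; lra.
Qed.

Lemma lim_toD v w l m : lim_to v l -> lim_to w m ->
  lim_to (fun n => v n + w n) (l + m).
Proof.
move=> vl wm e e0.
have [|N hN] := vl (e / 2); first by rewrite divr_gt0.
have [|M hM] := wm (e / 2); first by rewrite divr_gt0.
exists (maxn N M) => n; rewrite geq_max => /andP[/hN hn /hM hm].
by rewrite opprD addrACA (le_trans (ler_nrmD _ _))//; lra.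
Qed.

Lemma lim_to_shift v l : lim_to v l -> lim_to (fun n => v n.+1) l.
Proof.
move=> vl e e0; have [N hN] := vl e e0; exists N => n Nn.
by apply: hN; exact: leqW.
Qed.

Lemma lim_to_le v l (K : R) : lim_to v l -> (forall n, nrm (v n) <= K) ->
  nrm l <= K.
Proof.
move=> vl vK; apply/ler_addgt0Pl => e e0; have [N /(_ _ (leqnn N)) hN] := vl e e0.
by rewrite (le_trans (ler_nrm_dist l (v N)))// lerD// nrm_distC.
Qed.

End RealNorm.

Lemma lim_to_lip (R : realType) (V W : normedZmodType R[i]) (f : V -> W)
    (K : R) v l :
  (forall x y, nrm (f x - f y) <= K * nrm (x - y)) ->
  lim_to v l -> lim_to (fun n => f (v n)) (f l).
Proof.
move=> fK vl e e0; have K0 : 0 < `|K| + 1 by rewrite ltr_wpDl.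
have [|N hN] := vl (e / (`|K| + 1)); first by rewrite divr_gt0.
exists N => n /hN; rewrite ler_pdivlMr// => h.
have := fK (v n) l; have := nrm_ge0 (v n - l); have := ler_norm K; nra.
Qed.

Lemma nrmM (R : realType) (a b : R[i]) : nrm (a * b) = nrm a * nrm b.
Proof.
by apply: (@complexI R); rewrite rmorphM/= -!nrmE normrM.
Qed.

Lemma nrm_real (R : realType) (r : R) : nrm r%:C = `|r|.
Proof. by rewrite /nrm normc_def/= expr0n addr0 sqrtr_sqr. Qed.

Lemma nrm_conj (R : realType) (a : R[i]) : nrm (Num.conj a) = nrm a.
Proof. by rewrite /nrm norm_conjC. Qed.

Lemma nrm_sqr (R : realType) (a : R[i]) : a * Num.conj a = (nrm a ^+ 2)%:C.
Proof. by rewrite -normCK nrmE rmorphXn. Qed.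

(** * The inner product *)
Section Hilbert.
Variables (R : realType) (H : completeNormedModType R[i]).
Variable (dot : {dot H for Num.conj}).
Hypothesis Hdot : induces_norm dot.
Implicit Types x y z : H.

Lemma nrmZ (a : R[i]) x : nrm (a *: x) = nrm a * nrm x.
Proof. by apply: (@complexI R); rewrite rmorphM/= -!nrmE normrZ. Qed.

Lemma nrmZr (r : R) x : nrm (r%:C *: x) = `|r| * nrm x.
Proof. by rewrite nrmZ nrm_real. Qed.

Lemma dotC x y : dot x y = Num.conj (dot y x).
Proof. by rewrite hermC expr0 mul1r. Qed.

Lemma dotxx x : dot x x = (nrm x ^+ 2)%:C.
Proof. by rewrite -Hdot nrmE rmorphXn. Qed.

Lemma dotZl a x y : dot (a *: x) y = a * dot x y.
Proof. exact: linearZl_LR. Qed.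

Lemma dotZr a x y : dot x (a *: y) = Num.conj a * dot x y.
Proof. exact: linearZr_LR. Qed.

Lemma dotDl x y z : dot (x + y) z = dot x z + dot y z.
Proof. exact: linearDl. Qed.

Lemma dotDr x y z : dot z (x + y) = dot z x + dot z y.
Proof. exact: linearDr. Qed.

Lemma dotNl x z : dot (- x) z = - dot x z.
Proof. exact: linearNl. Qed.

Lemma dotNr x z : dot z (- x) = - dot z x.
Proof. exact: linearNr. Qed.

Lemma dot_ext x y : (forall z, dot x z = dot y z) -> x = y.
Proof.
move=> h; apply/eqP; rewrite -subr_eq0; apply/eqP/nrm0_eq0/eqP.
rewrite -sqrf_eq0; apply/eqP/(@complexI R).
by rewrite -dotxx dotDl dotNl h subrr.
Qed.

(** The squared norm of [|y|^2 x - <x, y> y] is nonnegative. *)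
Lemma CauchySchwarz_nrm x y : nrm (dot x y) <= nrm x * nrm y.
Proof.
have [->|/eqP y0] := eqVneq y 0.
  by rewrite linear0r !nrm0 mulr0.
have ny := nrm_gt0 y0.
pose z := (nrm y ^+ 2)%:C *: x - dot x y *: y.
have zz : dot z z = (nrm y ^+ 2 * (nrm x ^+ 2 * nrm y ^+ 2 - nrm (dot x y) ^+ 2))%:C.
  rewrite /z !(dotDl, dotDr, dotNl, dotNr, dotZl, dotZr) !dotxx.
  rewrite (dotC y x).
  have -> : Num.conj (nrm y ^+ 2)%:C = (nrm y ^+ 2)%:C :> R[i].
    by apply/CrealP; rewrite complex_real.
  have /= -> := rmorphM (real_complex R) (nrm y ^+ 2)
    (nrm x ^+ 2 * nrm y ^+ 2 - nrm (dot x y) ^+ 2).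
  have /= -> := rmorphB (real_complex R) (nrm x ^+ 2 * nrm y ^+ 2) (nrm (dot x y) ^+ 2).
  rewrite rmorphM /= -nrm_sqr.
  by ring.
have : 0 <= (nrm x ^+ 2 * nrm y ^+ 2 - nrm (dot x y) ^+ 2).
  rewrite -(@pmulr_rge0 _ (nrm y ^+ 2)) ?exprn_gt0// -ler0c -zz dotxx ler0c.
  by rewrite sqr_ge0.
rewrite -exprMn subr_ge0 ler_sqr ?nnegrE ?mulr_ge0 ?nrm_ge0//.
Qed.

Lemma lim_to_dotl v l y : lim_to v l ->
  lim_to (fun n => dot (v n) y : R[i]) (dot l y : R[i]).
Proof.
apply: (@lim_to_lip R H R[i] (fun x => dot x y) (nrm y)) => x z.
by rewrite -dotNl -dotDl mulrC CauchySchwarz_nrm.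
Qed.

Lemma lim_to_dotr v l y : lim_to v l ->
  lim_to (fun n => dot y (v n) : R[i]) (dot y l : R[i]).
Proof.
apply: (@lim_to_lip R H R[i] (fun x => dot y x) (nrm y)) => x z.
by rewrite -dotNr -dotDr CauchySchwarz_nrm.
Qed.

Lemma cauchy_lim_to (v : nat -> H) :
  (forall e : R, 0 < e -> exists N, forall m n, (N <= m)%N -> (N <= n)%N ->
     nrm (v m - v n) <= e) ->
  exists l, lim_to v l.
Proof.
move=> vC.
have cv : cvg ((v @ \oo)%classic : set_system H).
  apply/cauchy_cvgP/cauchy_exP => e e0.
  have er : e = (complex.Re e)%:C by rewrite RRe_real// ger0_real// ltW.
  have re0 : 0 < complex.Re e by rewrite -ltcR -er.
  have [|N hN] := vC (complex.Re e / 2); first by rewrite divr_gt0.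
  exists (v N), N => //= n /= Nn; rewrite -ball_normE /ball_/= nrmE er ltcR.
  by rewrite (le_lt_trans (hN _ _ (leqnn _) Nn))//; lra.
exists (lim ((v @ \oo)%classic : set_system H)) => e e0.
have /cvgrPdist_le /(_ e%:C) [|N _ hN] := cv; first by rewrite ltcR.
exists N => n Nn; have := hN n Nn.
by rewrite /= nrm_distC nrmE lecR.
Qed.

End Hilbert.

(** * Orthonormal families and approximate eigenvectors *)

(** Tests an identity between vectors against an arbitrary vector, which leaves
    an identity between scalars. *)
Local Ltac dot_ring Hdot := let t := fresh in
  apply: (dot_ext Hdot) => t; rewrite ?(dotDl, dotNl, dotZl); ring.

Section Ortho.
Variables (R : realType) (H : completeNormedModType R[i]).
Variable (dot : {dot H for Num.conj}).
Hypothesis Hdot : induces_norm dot.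
Implicit Types x y z : H.

Lemma conj_real (r : R) : Num.conj r%:C = r%:C :> R[i].
Proof. by apply/CrealP; rewrite complex_real. Qed.

Lemma dot_suml (I : Type) (s : seq I) (P : pred I) (F : I -> H) y :
  dot (\sum_(i <- s | P i) F i) y = \sum_(i <- s | P i) dot (F i) y.
Proof.
by elim/big_rec2: _ => [|i y1 y2 _ <-]; rewrite ?linear0l ?dotDl.
Qed.

Lemma dot_sumr (I : Type) (s : seq I) (P : pred I) (F : I -> H) y :
  dot y (\sum_(i <- s | P i) F i) = \sum_(i <- s | P i) dot y (F i).
Proof.
by elim/big_rec2: _ => [|i y1 y2 _ <-]; rewrite ?linear0r ?dotDr.
Qed.

Lemma dot_eq0C x y : dot x y = 0 -> dot y x = 0.
Proof. by rewrite (dotC dot y) => ->; rewrite rmorph0. Qed.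

Lemma pythagoras x y : dot x y = 0 -> nrm (x + y) ^+ 2 = nrm x ^+ 2 + nrm y ^+ 2.
Proof.
move=> xy; apply: (@complexI R).
rewrite -(dotxx Hdot) rmorphD/= -!(dotxx Hdot) !(dotDl, dotDr) xy (dot_eq0C xy).
by rewrite addr0 add0r.
Qed.

Section Family.
Variables (I : eqType) (e : I -> H) (s : seq I).
Hypotheses (us : uniq s)
  (es : {in s &, forall i j, dot (e i) (e j) = (i == j)%:R}).

Lemma family_coef (c : I -> R[i]) j : j \in s ->
  dot (\sum_(i <- s) c i *: e i) (e j) = c j.
Proof.
move=> js; rewrite dot_suml (bigD1_seq j)//= big_seq_cond big1 ?addr0.
  by rewrite dotZl es// eqxx mulr1.
by move=> i /andP[si /negbTE ij]; rewrite dotZl es// ij mulr0.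
Qed.

Lemma family_nrm (c : I -> R[i]) :
  nrm (\sum_(i <- s) c i *: e i) ^+ 2 = \sum_(i <- s) nrm (c i) ^+ 2.
Proof.
apply: (@complexI R); rewrite -(dotxx Hdot) dot_sumr rmorph_sum/=.
rewrite big_seq [RHS]big_seq; apply: eq_bigr => i si.
by rewrite dotZr family_coef// mulrC nrm_sqr.
Qed.

Lemma family_residual x j : j \in s ->
  dot (x - \sum_(i <- s) dot x (e i) *: e i) (e j) = 0.
Proof. by move=> js; rewrite dotDl dotNl family_coef// subrr. Qed.

Lemma bessel_eq x : nrm x ^+ 2 =
  nrm (x - \sum_(i <- s) dot x (e i) *: e i) ^+ 2 +
  \sum_(i <- s) nrm (dot x (e i)) ^+ 2.
Proof.
set S := \sum_(i <- s) dot x (e i) *: e i.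
rewrite -[in LHS](subrK S x) (@pythagoras (x - S) S).
  by congr (_ + _); exact: family_nrm.
by rewrite dot_sumr big_seq big1// => i si; rewrite dotZr family_residual// mulr0.
Qed.

Lemma bessel x : \sum_(i <- s) nrm (dot x (e i)) ^+ 2 <= nrm x ^+ 2.
Proof. by rewrite bessel_eq lerDr sqr_ge0. Qed.

End Family.

Definition orthonormal_list (l : seq H) :=
  uniq l /\ {in l &, forall u v, dot u v = (u == v)%:R}.

Lemma normalize x : x <> 0 -> nrm ((nrm x)^-1%:C *: x) = 1.
Proof.
move=> /nrm_gt0 x0; rewrite nrmZr ger0_norm ?invr_ge0 ?ltW// mulVf//.
by rewrite gt_eqF.
Qed.

Lemma orthonormal_list_cons l v : orthonormal_list l -> nrm v = 1 ->
  (forall u, u \in l -> dot v u = 0) ->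
  orthonormal_list (v :: l).
Proof.
move=> [ul lP] v1 vl.
have vv : dot v v = 1 by rewrite (dotxx Hdot) v1 expr1n.
have nvl : v \notin l.
  by apply/negP => /vl; rewrite vv => /eqP; rewrite oner_eq0.
split; first by rewrite /= nvl.
move=> a b; rewrite !inE => /predU1P[->|al] /predU1P[->|bl].
- by rewrite vv eqxx.
- by rewrite vl//; case: eqVneq nvl bl => // ->; move=> /negbTE ->.
- rewrite (dot_eq0C (vl _ al)); case: eqVneq nvl al => // ->.
  by move=> /negbTE ->.
- exact: lP.
Qed.

Hypothesis Hinf : infinite_dimensional H.

(** If no unit vector were orthogonal to the list, every vector would coincide
    with its projection onto the span of the list, and the space would be
    finite-dimensional. *)
Lemma unit_perp_list l : orthonormal_list l ->
  exists v, nrm v = 1 /\ forall u, u \in l -> dot v u = 0.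
Proof.
move=> [ul lP]; apply: contrapT => nex; apply: Hinf.
exists (size l), (fun i => l`_i) => x.
exists (fun i => dot x l`_i); set r := x - \sum_(u <- l) dot x u *: u.
have rl u : u \in l -> dot r u = 0 by apply: (@family_residual _ idfun).
have [r0|/eqP r0] := eqVneq r 0.
  move/eqP : r0; rewrite subr_eq0 => /eqP {1}->.
  by rewrite (big_nth 0) big_mkord.
case: nex; exists ((nrm r)^-1%:C *: r); split; first exact: normalize.
by move=> u /rl; rewrite dotZl => ->; rewrite mulr0.
Qed.

(** One step of the Gram-Schmidt process that never gets stuck: when [d] is
    already in the span of [l], any unit vector orthogonal to [l] will do. That
    [d] has been absorbed is expressed through orthogonal complements, which is
    the form in which completeness of the final basis is tested. *)
Lemma capture l d : orthonormal_list l -> exists v,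
  [/\ nrm v = 1, forall u, u \in l -> dot v u = 0 &
      forall x, (forall u, u \in v :: l -> dot x u = 0) -> dot x d = 0].
Proof.
move=> lP; have [ul lo] := lP; set r := d - \sum_(u <- l) dot d u *: u.
have rl u : u \in l -> dot r u = 0 by apply: (@family_residual _ idfun).
have dr : d = r + \sum_(u <- l) dot d u *: u by rewrite subrK.
have xd x (xl : forall u, u \in l -> dot x u = 0) : dot x d = dot x r.
  rewrite {1}dr dotDr dot_sumr big_seq big1 ?addr0// => u /xl.
  by rewrite dotZr => ->; rewrite mulr0.
have [r0|/eqP r0] := eqVneq r 0.
  have [v [v1 vl]] := unit_perp_list lP; exists v; split=> // x xl.
  by rewrite xd ?r0 ?linear0r// => u ul'; rewrite xl// inE ul' orbT.
exists ((nrm r)^-1%:C *: r); split; first exact: normalize.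
  by move=> u /rl; rewrite dotZl => ->; rewrite mulr0.
move=> x xl; rewrite xd; last by move=> u ul'; rewrite xl// inE ul' orbT.
have := xl _ (mem_head _ _); rewrite dotZr => /eqP; rewrite mulf_eq0 => /orP[|/eqP//].
rewrite conj_real; have := nrm_gt0 r0; rewrite -invr_gt0 => r0'.
by move=> /eqP r00; move: r0'; rewrite -ltcR r00 ltxx.
Qed.

Lemma orthonormalize (F : seq H) : exists l, orthonormal_list l /\
  forall x, (forall u, u \in l -> dot x u = 0) -> forall u, u \in F -> dot x u = 0.
Proof.
elim: F => [|d F [l [lP lF]]]; first by exists [::].
have [v [v1 vl vd]] := capture d lP; exists (v :: l); split.
  exact: orthonormal_list_cons.
move=> x xl u; rewrite inE => /predU1P[->|]; first exact: vd.
by apply: lF => w wl; rewrite xl// inE wl orbT.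
Qed.

Lemma unit_perp (F : seq H) :
  exists v, nrm v = 1 /\ forall u, u \in F -> dot v u = 0.
Proof.
have [l [lP lF]] := orthonormalize F; have [v [v1 vl]] := unit_perp_list lP.
by exists v; split=> //; apply: lF.
Qed.

Definition selfadj (f : H -> H) := forall x y, dot (f x) y = dot x (f y).
Definition bounded_by (K : R) (f : H -> H) := forall x, nrm (f x) <= K * nrm x.

Lemma selfadj_dot_real f x : selfadj f -> dot (f x) x = (complex.Re (dot (f x) x))%:C.
Proof.
by move=> fs; rewrite RRe_real//; apply/CrealP; rewrite -dotC fs.
Qed.

Lemma Re_le_nrm (a : R[i]) : complex.Re a <= nrm a.
Proof.
rewrite -lecR -nrmE (le_trans _ (normc_ge_Re a))// lecR; exact: ler_norm.
Qed.

Lemma Re_ge_nrm (a : R[i]) : - nrm a <= complex.Re a.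
Proof. by have := Re_le_nrm (- a); rewrite nrmN raddfN/= lerNl. Qed.

(** [lam] is the infimum over all finite sets [F0] of the supremum of the
    quadratic form of [A] on the unit vectors orthogonal to [F0], that is, the
    top of the essential spectrum. For [t] slightly above [lam] and a suitable
    [F0], the form of [t - A] is nonnegative on the complement of [F0] and nearly
    vanishes at some unit [x] there; a nonnegative form that nearly vanishes at
    [x] has a small gradient at [x], which bounds [A x - lam x]. *)
Lemma approximate_eigenvalue (A : {linear H -> H}) (K : R) :
  selfadj A -> bounded_by K A ->
  exists lam : R, forall eps (F : seq H), 0 < eps -> exists x,
    [/\ nrm x = 1, forall u, u \in F -> dot x u = 0 &
        nrm (A x - lam%:C *: x) <= eps].
Proof.
move=> As AK.
pose q x := complex.Re (dot (A x) x).
have qK x : `|q x| <= K * nrm x ^+ 2.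
  have h : nrm (dot (A x) x) <= K * nrm x ^+ 2.
    rewrite expr2 mulrA (le_trans (CauchySchwarz_nrm Hdot _ _))//.
    by rewrite ler_wpM2r// nrm_ge0.
  rewrite ler_norml; have := Re_le_nrm (dot (A x) x).
  by have := Re_ge_nrm (dot (A x) x); rewrite /q; lra.
pose perp F x := forall u : H, u \in (F : seq H) -> dot x u = 0.
pose L := [set t : R | exists F, forall x, perp F x -> q x <= t * nrm x ^+ 2]%classic.
have LK : L K by exists [::] => x _; rewrite (le_trans (ler_norm _)).
have Llb t : L t -> - K <= t.
  move=> [F Ft]; have [v [v1 vF]] := unit_perp F.
  by have := Ft v vF; have := qK v; rewrite v1 expr1n !mulr1 ler_norml; lra.
have hL : has_inf L by split; [exists K | exists (- K) => t /Llb].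
exists (inf L) => eps F e0; set lam := inf L.
have lamK : `|lam| <= `|K|.
  rewrite ler_norml; apply/andP; split.
    rewrite (le_trans _ (lb_le_inf hL.1 Llb))// lerN2; exact: ler_norm.
  by rewrite (le_trans (ge_inf hL.2 LK))// ler_norm.
pose M := `|K| + `|K| + 2.
have M0 : 0 < M by have := normr_ge0 K; rewrite /M; lra.
(* [M] bounds the form of [t - A] for every [t] within 1 of [lam]; the choice of [d]
   makes both [|t - lam|] and the gradient estimate [2 d M] small enough. *)
pose d := Num.min 1 (Num.min (eps / 2) (eps ^+ 2 / (8 * M))).
have d0 : 0 < d by rewrite !lt_min ltr01 !divr_gt0// ?exprn_gt0// mulr_gt0.
have [d1 d2 d3] : [/\ d <= 1, d <= eps / 2 & d * (8 * M) <= eps ^+ 2].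
  rewrite -ler_pdivlMr ?mulr_gt0// /d; split; rewrite !ge_min lexx ?orbT//.
have [t [F0 F0t] tlam] := inf_adherent d0 hL.
have tl : lam <= t by apply: (ge_inf hL.2); exists F0.
have [x [Fx qx]] : exists x, perp (F ++ F0 ++ map A F0) x /\
    (lam - d) * nrm x ^+ 2 < q x.
  apply: contrapT => nex.
  suff /(ge_inf hL.2) : L (lam - d) by rewrite -/lam; lra.
  exists (F ++ F0 ++ map A F0) => x Fx; rewrite leNgt; apply/negP => qx.
  by apply: nex; exists x.
have x0 : x <> 0.
  by move=> x0; move: qx; rewrite /q x0 linear0r nrm0 expr0n/= mulr0 ltxx.
have nx := nrm_gt0 x0.
exists ((nrm x)^-1%:C *: x); split; first exact: normalize.
  by move=> u uF; rewrite dotZl Fx ?mulr0// mem_cat uF.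
set w := _ *: x; have w1 : nrm w = 1 by exact: normalize.
have Fw : perp (F ++ F0 ++ map A F0) w.
  by move=> u uF; rewrite dotZl Fx ?mulr0.
have qw : lam - d < q w.
  rewrite /q; have -> : A w = (nrm x)^-1%:C *: A x by rewrite /w linearZ.
  rewrite /w dotZl dotZr conj_real mulrA -rmorphM/= selfadj_dot_real//.
  rewrite -rmorphM/= -expr2 exprVn mulrC ltr_pdivlMr ?exprn_gt0//.
clearbody w.
(* the form <(t - A) x, y> is positive on the orthogonal of F0 *)
pose y := t%:C *: w - A w.
have Fy : perp F0 y.
  move=> u uF0; rewrite /y dotDl dotNl As dotZl !Fw ?mulr0 ?subrr//.
    by rewrite !mem_cat map_f ?orbT.
  by rewrite !mem_cat uF0 !orbT.
have yw : A w = t%:C *: w - y by rewrite /y subKr.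
clearbody y.
(* The form of [t - A] at [w - s y] is nonnegative; it is used at [s = 1 / M]. *)
have key (s : R) : 2 * s * nrm y ^+ 2 <= 2 * d + s ^+ 2 * (M * nrm y ^+ 2).
  pose z := w - s%:C *: y.
  have Fz : perp F0 z.
    move=> u uF0; rewrite /z dotDl dotNl dotZl Fy// Fw ?mulr0 ?subrr//.
    by rewrite !mem_cat uF0 orbT.
  have : 0 <= t * nrm z ^+ 2 - q z by rewrite subr_ge0 F0t.
  have -> : t * nrm z ^+ 2 - q z =
      (t - q w) - 2 * s * nrm y ^+ 2 + s ^+ 2 * (t * nrm y ^+ 2 - q y).
    apply: (@complexI R); rewrite /q !(rmorphB, rmorphD, rmorphM, rmorphXn, rmorph1)/=.
    have ww : dot w w = 1 by rewrite (dotxx Hdot) w1 expr1n.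
    have ee : (nrm y)%:C * (nrm y)%:C = dot y y by rewrite (dotxx Hdot) -rmorphM.
    have ez : (nrm z)%:C * (nrm z)%:C = dot z z by rewrite (dotxx Hdot) -rmorphM.
    rewrite -!(selfadj_dot_real _ As) ee ez.
    have -> : A z = A w - s%:C *: A y by rewrite /z linearB linearZ.
    rewrite /z.
    rewrite !(dotDl, dotDr, dotNl, dotNr, dotZl, dotZr) !conj_real ww.
    rewrite (As y w).
    by rewrite yw !(dotDl, dotDr, dotNl, dotNr, dotZl, dotZr) !conj_real ww; ring.
  have : t * nrm y ^+ 2 - q y <= M * nrm y ^+ 2.
    have := qK y; have := sqr_ge0 (nrm y); rewrite ler_norml /M.
    have : t * nrm y ^+ 2 <= (`|K| + 1) * nrm y ^+ 2.
      rewrite ler_wpM2r ?sqr_ge0//; have := ler_norm lam; lra.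
    have : K * nrm y ^+ 2 <= `|K| * nrm y ^+ 2.
      by rewrite ler_wpM2r ?sqr_ge0// ler_norm.
    nra.
  have := sqr_ge0 s; nra.
have ny : nrm y <= eps / 2.
  rewrite -ler_sqr ?nnegrE ?nrm_ge0//; last by rewrite ltW// divr_gt0.
  have := key M^-1; have Mi : 0 < M^-1 by rewrite invr_gt0.
  have -> : M^-1 ^+ 2 * (M * nrm y ^+ 2) = M^-1 * nrm y ^+ 2.
    by field; rewrite gt_eqF.
  move=> k; have : M^-1 * nrm y ^+ 2 <= 2 * d by lra.
  rewrite mulrC ler_pdivrMr// => k2.
  have := d3; nra.
have -> : A w - lam%:C *: w = (t - lam)%:C *: w - y.
  by rewrite yw rmorphB scalerBl addrAC.
rewrite (le_trans (ler_nrmB _ _))// nrmZr w1 mulr1.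
rewrite ger0_norm ?subr_ge0//; have := d2; lra.
Qed.

End Ortho.

(** * An action of the infinite dihedral group on the natural numbers *)
Section DihedralIndex.
Local Notation I := ((bool * int) * nat)%type.

Let q1 (i : I) : I := ((~~ i.1.1, i.1.2), i.2).
Let q2 (i : I) : I :=
  ((~~ i.1.1, if i.1.1 then i.1.2 + 1 else i.1.2 - 1), i.2).

Let q21 n (i : I) : iter n (q2 \o q1) i =
  ((i.1.1, if i.1.1 then i.1.2 - n%:Z else i.1.2 + n%:Z), i.2).
Proof.
elim: n => [|n IH]; first by case: i => [[[] q] k] /=; rewrite ?subr0 ?addr0.
rewrite iterS IH /q2 /q1 /=; case: i {IH} => [[[] q] k] /=.
  by congr (_, _, _); lia.
by congr (_, _, _); lia.
Qed.

(** The index set is identified with [bool * int * nat], where [(b, q)] stands for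
    the level [2 q + b] on the integer line and the last component counts inside
    a level. [p1] matches the levels [2 q] and [2 q + 1], [p2] matches [2 q - 1]
    and [2 q], so [p2 \o p1] moves even levels up and odd levels down by two.
    [s] is the parity of the level, [G] is the level 0, and [cap] enumerates
    it. *)
Lemma dihedral_index : exists (p1 p2 : nat -> nat) (s G : nat -> bool)
    (cap : nat -> nat),
  [/\ [/\ involutive p1, involutive p2, forall m, s (p1 m) = ~~ s m &
          forall m, s (p2 m) = ~~ s m],
      forall m, injective (fun n => iter n (p2 \o p1) m),
      forall m m' n n', G m -> G m' ->
        iter n (p2 \o p1) m = iter n' (p2 \o p1) m' -> n = n' /\ m = m' &
      forall k, exists2 m, G m & cap m = k].
Proof.
have infI : ~ finite_set [set: I].
  move=> /(finite_image (fun i : I => i.2)) fin; apply: infinite_nat.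
  by apply: sub_finite_set fin => k _; exists ((true, 0), k).
have [f [g fK gK]] : exists f : nat -> I, bijective f.
  have /card_set_bijP [g] : ([set: I] #= [set: nat])%card.
    by apply: eq_card_nat => //; exact: countableP.
  by rewrite setTT_bijective => -[f gK fK]; exists f; exists g.
pose p q m := g (q (f m)).
have itp n m : iter n (p q2 \o p q1) m = g (iter n (q2 \o q1) (f m)).
  by elim: n => [|n IH]; [rewrite /= fK | rewrite !iterS IH /p /= !gK].
exists (p q1), (p q2), (fun m => (f m).1.1), (fun m => (f m).1 == (false, 0)),
  (fun m => (f m).2); split.
- split=> m; rewrite /p ?gK// /q1/q2/=.
    by rewrite negbK -surjective_pairing -surjective_pairing fK.
  apply: (canLR fK); case: (f m) => [[[] q] k] /=.
    by rewrite addrK.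
  by rewrite subrK.
- move=> m n n' /=; rewrite !itp => /(can_inj gK); rewrite !q21.
  by case: (f m) => [[[] q] k] /= [] /eqP; lia.
- move=> m m' n n' /eqP fm /eqP fm'; rewrite !itp => /(can_inj gK).
  rewrite !q21 fm fm' /= !add0r => -[-> kk]; split=> //.
  apply: (can_inj fK).
  by rewrite (surjective_pairing (f m)) (surjective_pairing (f m')) fm fm' kk.
- by move=> k; exists (g ((false, 0), k)); rewrite gK.
Qed.

End DihedralIndex.

(** All convergence statements below come from bounded sums of nonnegative
    terms through this remark. *)
Lemma bounded_mono_cauchy (R : realType) (S : nat -> R) (K : R) :
  {homo S : m n / (m <= n)%N >-> m <= n} -> (forall n, S n <= K) ->
  forall eps, 0 < eps -> exists N, forall n m, (N <= n)%N -> S m - S n <= eps.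
Proof.
move=> Sm SK eps e0.
have hS : has_sup (range S).
  by split; [exists (S 0%N), 0%N | exists K => _ [n _ <-]].
have [_ [N _ <-] hN] := sup_adherent e0 hS.
exists N => n m /Sm Nn; rewrite lerBlDr.
have : S m <= sup (range S) by apply: (ub_le_sup hS.2); exists m.
lra.
Qed.

(** * Orthonormal bases and operators permuting them *)
Section Basis.
Variables (R : realType) (H : completeNormedModType R[i]).
Variable (dot : {dot H for Num.conj}).
Hypothesis Hdot : induces_norm dot.
Implicit Types x y z : H.

Definition orthonormal_seq (e : nat -> H) := forall i j, dot (e i) (e j) = (i == j)%:R.
Definition orthonormal_basis (e : nat -> H) :=
  orthonormal_seq e /\ forall x, (forall j, dot x (e j) = 0) -> x = 0.

Lemma lim_to_sqr_le v (l : H) (K : R) : lim_to v l -> 0 <= K ->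
  (forall n, nrm (v n) ^+ 2 <= K ^+ 2) -> nrm l <= K.
Proof.
move=> vl K0 vK; apply: (lim_to_le vl) => n.
by rewrite -ler_sqr ?nnegrE ?nrm_ge0.
Qed.

(** Riesz-Fischer: the partial sums are Cauchy because their distances are
    tails of a bounded series. *)
Lemma orthonormal_series (e : nat -> H) (c : nat -> R[i]) (K : R) : orthonormal_seq e ->
  (forall M, \sum_(0 <= m < M) nrm (c m) ^+ 2 <= K) ->
  exists l, lim_to (fun M => \sum_(0 <= m < M) c m *: e m) l.
Proof.
move=> eo cK;
apply: (cauchy_lim_to (v := fun M => \sum_(0 <= m < M) c m *: e m)) => eps e0.
pose S M := \sum_(0 <= m < M) nrm (c m) ^+ 2.
have Sm : {homo S : m n / (m <= n)%N >-> m <= n}.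
  move=> m n mn; rewrite /S (big_cat_nat (leq0n m) mn)/= lerDl.
  by apply: sumr_ge0 => i _; exact: sqr_ge0.
have [N hN] := bounded_mono_cauchy Sm cK (exprn_gt0 2 e0).
have h m n : (N <= n)%N -> (n <= m)%N ->
    nrm (\sum_(0 <= i < m) c i *: e i - \sum_(0 <= i < n) c i *: e i) <= eps.
  move=> Nn nm; rewrite (big_cat_nat (leq0n n) nm)/= addrAC subrr add0r.
  rewrite -ler_sqr ?nnegrE ?nrm_ge0 ?(ltW e0)// (family_nrm Hdot) ?iota_uniq//.
  have := hN n m Nn; rewrite /S (big_cat_nat (leq0n n) nm)/=. lra.
exists N => m n Nm Nn; have [mn|/ltnW nm] := leqP m n; last exact: h.
by rewrite nrm_distC h.
Qed.

Section OnBasis.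
Variable e : nat -> H.
Hypothesis eb : orthonormal_basis e.

Lemma basis_bessel s x : uniq s -> \sum_(i <- s) nrm (dot x (e i)) ^+ 2 <= nrm x ^+ 2.
Proof. by move=> us; apply: bessel => // i j _ _; exact: eb.1. Qed.

Lemma basis_ext x y : (forall j, dot x (e j) = dot y (e j)) -> x = y.
Proof.
move=> xy; apply/eqP; rewrite -subr_eq0; apply/eqP/eb.2 => j.
by rewrite dotDl dotNl xy subrr.
Qed.

Lemma orthonormal_series_coef (f : nat -> H) (c : nat -> R[i]) l j :
  orthonormal_seq f ->
  lim_to (fun M => \sum_(0 <= m < M) c m *: f m) l -> dot l (f j) = c j.
Proof.
move=> fo /(lim_to_dotl Hdot (f j)) h; apply: (lim_to_uniq h).
apply: (@lim_to_ev _ _ j.+1 (fun=> c j)); last exact: lim_to_cst.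
move=> n jn; rewrite (@family_coef _ _ _ _ f) ?iota_uniq ?mem_index_iota//.
Qed.

Lemma expansion x : lim_to (fun M => \sum_(0 <= m < M) dot x (e m) *: e m) x.
Proof.
have [|l hl] := orthonormal_series (K := nrm x ^+ 2) (c := fun m => dot x (e m)) eb.1.
  by move=> M; rewrite basis_bessel ?iota_uniq.
suff xl : l = x by rewrite xl in hl.
by apply: basis_ext => j; rewrite (orthonormal_series_coef _ eb.1 hl).
Qed.

(** Moving [f] to the other side of the inner product makes it additive and
    homogeneous; thus only self-adjointness has to be checked for the operators
    that are built by hand. *)
Lemma selfadj_linear (f : H -> H) : selfadj dot f -> exists g : {linear H -> H}, g =1 f.
Proof.
move=> fs.
have fl : linear f.
  move=> a x y; apply: (dot_ext Hdot) => z.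
  by rewrite fs !(dotDl, dotZl) !fs.
pose gM := GRing.isLinear.Build _ _ _ _ f fl.
pose g : {linear H -> H} := HB.pack f gM.
by exists g.
Qed.

(** The operator sending [e m] to [w m *: e (p m)]. It is self-adjoint because
    [p] is an involution that preserves the weights. Permutation symmetries,
    diagonal sign operators and diagonal contractions are all of this form. *)
Lemma weighted_perm (p : nat -> nat) (w : nat -> R) : involutive p ->
  (forall m, `|w m| <= 1) -> (forall m, w (p m) = w m) ->
  exists J : {linear H -> H}, [/\ selfadj dot J, bounded_by 1 J &
    forall x m, dot (J x) (e m) = (w m)%:C * dot x (e (p m))].
Proof.
move=> pK w1 wp; have epo : orthonormal_seq (e \o p).
  by move=> i j; rewrite eb.1 (can_eq pK).
have wb x M : \sum_(0 <= m < M) nrm ((w m)%:C * dot x (e m)) ^+ 2 <= nrm x ^+ 2.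
  apply: le_trans (basis_bessel x (iota_uniq 0 M)).
  rewrite /index_iota subn0; apply: ler_sum => i _.
  rewrite nrmM nrm_real ler_sqr ?nnegrE ?mulr_ge0 ?nrm_ge0//.
  by rewrite ler_piMl ?nrm_ge0.
have /choice[J hJ] x := orthonormal_series epo (wb x).
have Js : selfadj dot J.
  move=> x y; have h1 := lim_to_dotl Hdot (y) (hJ x).
  have h2 := lim_to_dotl Hdot (J y) (expansion x).
  apply: (lim_to_uniq h1); apply: lim_to_ext h2 => M.
  rewrite !dot_suml; apply: eq_bigr => i _; rewrite !dotZl.
  have -> : dot (e i) (J y) = (w i)%:C * dot (e (p i)) y.
    rewrite (dotC dot) -{1}(pK i) (orthonormal_series_coef (p i) epo (hJ y)).
    by rewrite rmorphM/= conj_real -dotC wp.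
  by rewrite mulrCA mulrA.
have [J' JJ'] := selfadj_linear Js; exists J'; split.
- by move=> x y; rewrite !JJ'.
- move=> x; rewrite JJ' mul1r; apply: (lim_to_sqr_le (hJ x)); first exact: nrm_ge0.
  move=> M; rewrite (le_trans _ (wb x M))//.
  rewrite (@family_nrm _ _ _ Hdot _ (e \o p)) ?iota_uniq//.
- by move=> x m; rewrite JJ' -{1}(pK m) (orthonormal_series_coef (p m) epo (hJ x)) wp.
Qed.

End OnBasis.
End Basis.

(** * A basis adapted to an operator *)
Section AdaptedBasis.
Variables (R : realType) (H : completeNormedModType R[i]).
Variable (dot : {dot H for Num.conj}).
Hypothesis Hdot : induces_norm dot.
Hypothesis Hsep : separable H.
Hypothesis Hinf : infinite_dimensional H.
Implicit Types x y z : H.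

Lemma dense_seq : exists d : nat -> H,
  forall x (eps : R), 0 < eps -> exists k, nrm (x - d k) <= eps.
Proof.
have [S /countable_injP[f finj] Sd] := Hsep.
have /choice[d dP] (k : nat) : exists y, forall s, S s -> f s = k -> s = y.
  have [[s [Ss fs]]|ns] := pselect (exists s, S s /\ f s = k).
    by exists s => t St ft; apply: finj; rewrite ?inE// ft.
  by exists 0 => s Ss fs; case: ns; exists s.
exists d => x eps e0.
have [|y [xy Sy]] := Sd (ball x eps%:C) _ (ball_open _ _).
  by exists x; apply: ballxx; rewrite ltcR.
exists (f y); rewrite -(dP _ _ Sy erefl).
by move: xy; rewrite -ball_normE /ball_/= nrmE ltcR => /ltW.
Qed.

(** The basis is chosen vector by vector. At an index outside [G] the new
    vector makes [A] small; at an index [m] in [G] it absorbs the vector number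
    [cap m] of a dense sequence. As [cap] hits every number on [G], the result is
    complete. *)
Lemma adapted_basis (A : H -> H) (th : nat -> R) (G : nat -> bool)
    (cap : nat -> nat) :
  (forall eps (F : seq H), 0 < eps -> exists x,
    [/\ nrm x = 1, forall u, u \in F -> dot x u = 0 & nrm (A x) <= eps]) ->
  (forall m, 0 < th m) -> (forall k, exists2 m, G m & cap m = k) ->
  exists e : nat -> H, orthonormal_basis dot e /\
    forall m, ~~ G m -> nrm (A (e m)) <= th m.
Proof.
move=> Aeps th0 capP; have [d dd] := dense_seq.
have /choice[step stepP] (nl : nat * seq H) : exists v, orthonormal_list dot nl.2 ->
    [/\ nrm v = 1, forall u, u \in nl.2 -> dot v u = 0,
        ~~ G nl.1 -> nrm (A v) <= th nl.1 &
        G nl.1 -> forall x, (forall u, u \in v :: nl.2 -> dot x u = 0) ->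
          dot x (d (cap nl.1)) = 0].
  case: nl => n l /=;
  have [lP|nlP] := pselect (orthonormal_list dot l); last by exists 0.
  have [Gn|nGn] := boolP (G n).
    have [v [v1 vl vd]] := capture Hinf (d (cap n)) lP.
    by exists v => _; split.
  have [v [v1 vl vA]] := Aeps (th n) l (th0 n).
  by exists v => _; split.
pose L := fix L n := if n is m.+1 then step (m, L m) :: L m else [::].
pose e n := step (n, L n).
have Lon n : orthonormal_list dot (L n).
  elim: n => [//|n IH]; have [v1 vl _ _] := stepP (n, L n) IH.
  by apply: orthonormal_list_cons.
have eL i n : (i < n)%N -> e i \in L n.
  elim: n => [//|n IH]; rewrite ltnS leq_eqVlt => /predU1P[->|/IH] /=.
    exact: mem_head.
  by rewrite inE => ->; rewrite orbT.
have Le n u : u \in L n -> exists i, u = e i.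
  elim: n => [//|n IH] /=; rewrite inE => /predU1P[->|/IH//].
  by exists n.
exists e; split; last first.
  by move=> m nG; have [_ _ h _] := stepP (m, L m) (Lon m); exact: h.
split=> [i j|x xe].
  have [ij|ij|->] := ltngtP i j.
  - have [_ h _ _] := stepP (j, L j) (Lon j).
    by rewrite (dot_eq0C (h _ (eL _ _ ij))).
  - have [_ h _ _] := stepP (i, L i) (Lon i).
    by rewrite h ?eL.
  - have [h _ _ _] := stepP (j, L j) (Lon j).
    by rewrite (dotxx Hdot) h expr1n.
have xd k : dot x (d k) = 0.
  have [m Gm <-] := capP k; have [_ _ _ h] := stepP (m, L m) (Lon m).
  by apply: h => //= u; rewrite -[_ :: _]/(L m.+1) => /Le[i ->].
apply/nrm0_eq0/eqP; rewrite eq_le nrm_ge0 andbT.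
apply/ler_addgt0Pl => eps e0; rewrite addr0.
have [k hk] := dd x eps e0.
have [->|/eqP x0] := eqVneq x 0; first by rewrite nrm0 ltW.
have : dot x x = dot x (x - d k) by rewrite dotDr dotNr xd subr0.
rewrite (dotxx Hdot) => xx; have := CauchySchwarz_nrm Hdot x (x - d k).
rewrite -xx nrm_real ger0_norm ?sqr_ge0// expr2 ler_pM2l ?nrm_gt0//.
by move/le_trans; apply.
Qed.

End AdaptedBasis.

(** * Summing an operator along the orbits of a shift *)
Section Telescope.
Variables (R : realType) (H : completeNormedModType R[i]).
Variable (dot : {dot H for Num.conj}).
Hypothesis Hdot : induces_norm dot.
Implicit Types x y z : H.
Variable e : nat -> H.
Hypothesis eb : orthonormal_basis dot e.

Lemma basis_nrm m : nrm (e m) = 1.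
Proof.
apply/eqP; rewrite -sqrp_eq1 ?nrm_ge0//; apply/eqP/(@complexI R).
by rewrite -(dotxx Hdot) eb.1 eqxx.
Qed.

(** Parseval for finitely many vectors at once, in the approximate form needed
    to bound a sum of norms by finite sums of squared coefficients. *)
Lemma parseval_sum (z : nat -> H) N (eps : R) : 0 < eps ->
  exists M0, forall M, (M0 <= M)%N ->
  \sum_(0 <= n < N) nrm (z n) ^+ 2 <=
  \sum_(0 <= n < N) \sum_(0 <= m < M) nrm (dot (z n) (e m)) ^+ 2 + eps.
Proof.
elim: N eps => [|N IH] eps e0.
  by exists 0%N => M _; rewrite !big_geq// add0r ltW.
have e2 : 0 < eps / 2 by rewrite divr_gt0.
have [M1 h1] := IH _ e2.
have m0 : 0 < Num.min 1 (eps / 2) by rewrite lt_min ltr01.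
have [M2 h2] := expansion Hdot eb (z N) m0.
exists (maxn M1 M2) => M; rewrite geq_max => /andP[/h1 {}h1 /h2 {}h2].
rewrite !big_nat_recr//=.
have := @bessel_eq _ _ _ Hdot _ e (index_iota 0 M) (iota_uniq _ _) _ (z N).
move=> /(_ (fun i j _ _ => eb.1 i j)) ->.
move: h2; rewrite nrm_distC; set r := nrm (_ - _) => r1.
have : r ^+ 2 <= eps / 2.
  have : 0 <= r := nrm_ge0 _.
  move: r1; rewrite le_min => /andP[r1 r2] r0; nra.
lra.
Qed.

Variable G : nat -> bool.
(** The weights of the seminorm that controls the operator: full weight on
    [G], summable weights elsewhere. *)
Definition weight (m : nat) : R := if G m then 1 else 2^-1 ^+ m.

Lemma geom_le2 M : \sum_(0 <= m < M) (2^-1 ^+ m : R) <= 2.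
Proof.
have -> : \sum_(0 <= m < M) (2^-1 ^+ m : R) = 2 - 2 * 2^-1 ^+ M.
  elim: M => [|M IH]; first by rewrite big_geq// expr0; ring.
  by rewrite big_nat_recr//= IH exprS; field.
by rewrite gerBl mulr_ge0// exprn_ge0// invr_ge0.
Qed.

Lemma weight_gt0 m : 0 < weight m.
Proof. by rewrite /weight; case: ifP => // _; rewrite exprn_gt0// invr_gt0. Qed.

Lemma weight_le1 m : weight m <= 1.
Proof.
rewrite /weight; case: ifP => // _; rewrite exprn_ile1// ?invr_ge0//.
by rewrite invf_le1// ler1n.
Qed.

Lemma sum_weight M : \sum_(0 <= m < M | ~~ G m) weight m <= 2.
Proof.
apply: le_trans (geom_le2 M); rewrite [leRHS](bigID G)/=.
rewrite ler_wpDl//; first by apply: sumr_ge0 => i _; rewrite exprn_ge0// invr_ge0.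
by apply: ler_sum => i /negbTE Gi; rewrite /weight Gi.
Qed.

Variables (A : {linear H -> H}) (K : R).
Hypotheses (As : selfadj dot A) (AK : bounded_by K A) (K0 : 0 <= K).
Hypothesis AG : forall m, ~~ G m -> nrm (A (e m)) <= weight m ^+ 4.
Variable D : {linear H -> H}.
Hypothesis DE : forall x m, dot (D x) (e m) = (weight m)%:C * dot x (e m).

Let low M x := \sum_(0 <= m < M | G m) dot x (e m) *: e m.
Let high M x := \sum_(0 <= m < M | ~~ G m) dot x (e m) *: e m.

Lemma coef_le x m : weight m * nrm (dot x (e m)) <= nrm (D x).
Proof.
have -> : weight m * nrm (dot x (e m)) = nrm (dot (D x) (e m)).
  by rewrite DE nrmM nrm_real ger0_norm// ltW// weight_gt0.
by rewrite (le_trans (CauchySchwarz_nrm Hdot _ _))// basis_nrm mulr1.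
Qed.

Lemma low_le M x : nrm (low M x) <= nrm (D x).
Proof.
rewrite -ler_sqr ?nnegrE ?nrm_ge0// /low -big_filter.
rewrite (family_nrm Hdot) ?filter_uniq ?iota_uniq//; last first.
  by move=> i j _ _; exact: eb.1.
apply: le_trans (basis_bessel Hdot eb (D x) (filter_uniq G (iota_uniq 0 (M - 0)))).
rewrite le_eqVlt; apply/orP; left; apply/eqP; apply: eq_big_seq => i.
by rewrite mem_filter => /andP[Gi _]; rewrite DE /weight Gi mul1r.
Qed.

Lemma high_le M x : nrm (A (high M x)) <= 2 * nrm (D x).
Proof.
rewrite /high linear_sum (le_trans (ler_nrm_sum _ _ _))//.
apply: (@le_trans _ _ (\sum_(0 <= m < M | ~~ G m) weight m * nrm (D x))).
  apply: ler_sum => i /AG Ai; rewrite linearZ/= nrmZ.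
  have := coef_le x i; have := weight_gt0 i; have := weight_le1 i.
  have := nrm_ge0 (A (e i)); have := nrm_ge0 (dot x (e i)); have := nrm_ge0 (D x).
  move: Ai; set w := weight i; set a := nrm (A _).
  set c := nrm (dot _ _); set d := nrm _.
  move=> aw d0 c0 a0 w1 w0 wc.
  have h1 : c * a <= c * w ^+ 4 by rewrite ler_wpM2l.
  have h2 : w ^+ 3 <= w by rewrite exprS ger_pMr ?exprn_ile1// ltW.
  have h3 : w ^+ 3 * (w * c) <= w * d.
    by apply: ler_pM => //; rewrite ?mulr_ge0 ?exprn_ge0// ltW.
  by apply: le_trans h1 (le_trans _ h3); rewrite mulrA -exprSr mulrC.
by rewrite -mulr_suml ler_wpM2r ?nrm_ge0// sum_weight.
Qed.

(** By self-adjointness the matrix entry of [A] at [(k, l)] is at most the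
    smaller of the fourth powers of the two weights, hence at most
    [weight k ^+ 2 * weight l ^+ 2]: this leaves one spare factor of each weight
    to sum over. *)
Lemma high_high_le M N x y :
  nrm (dot (A (high M x)) (high N y)) <= 4 * (nrm (D x) * nrm (D y)).
Proof.
rewrite /high (linear_sum A) dot_suml (le_trans (ler_nrm_sum _ _ _))//.
apply: (@le_trans _ _ (\sum_(0 <= k < M | ~~ G k) \sum_(0 <= l < N | ~~ G l)
    (weight k * weight l * (nrm (D x) * nrm (D y))))).
  apply: ler_sum => k Gk; rewrite dot_sumr (le_trans (ler_nrm_sum _ _ _))//.
  apply: ler_sum => l Gl; rewrite (linearZ_LR A)/= dotZl dotZr !nrmM nrm_conj.
  have wk := weight_gt0 k; have wl := weight_gt0 l.
  have h1 : nrm (dot (A (e k)) (e l)) <= weight k ^+ 4.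
    rewrite (le_trans (CauchySchwarz_nrm Hdot _ _))// basis_nrm mulr1; exact: AG.
  have h2 : nrm (dot (A (e k)) (e l)) <= weight l ^+ 4.
    by rewrite As (le_trans (CauchySchwarz_nrm Hdot _ _))// basis_nrm mul1r AG.
  have h : nrm (dot (A (e k)) (e l)) <= weight k ^+ 2 * weight l ^+ 2.
    rewrite -ler_sqr ?nnegrE ?nrm_ge0 ?mulr_ge0 ?exprn_ge0 ?(ltW wk) ?(ltW wl)//.
    have -> : (weight k ^+ 2 * weight l ^+ 2) ^+ 2 = weight k ^+ 4 * weight l ^+ 4.
      by ring.
    by rewrite expr2; apply: ler_pM => //; exact: nrm_ge0.
  have ck := coef_le x k; have cl := coef_le y l.
  have h3 : (weight k * nrm (dot x (e k))) * (weight l * nrm (dot y (e l)))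
      <= nrm (D x) * nrm (D y).
    by apply: ler_pM => //; rewrite mulr_ge0 ?nrm_ge0// ltW.
  have h4 : nrm (dot x (e k)) * (nrm (dot y (e l)) * nrm (dot (A (e k)) (e l)))
     <= nrm (dot x (e k)) * (nrm (dot y (e l)) * (weight k ^+ 2 * weight l ^+ 2)).
    by rewrite !ler_wpM2l ?nrm_ge0.
  apply: le_trans h4 _.
  have := ler_wpM2l (mulr_ge0 (ltW wk) (ltW wl)) h3.
  by apply: le_trans; rewrite le_eqVlt; apply/orP; left; apply/eqP; ring.
under eq_bigr => k _.
  rewrite -mulr_suml -mulr_sumr; over.
rewrite -mulr_suml -mulr_suml ler_wpM2r ?mulr_ge0 ?nrm_ge0//.
have -> : (4 : R) = 2 * 2 by ring.
apply: ler_pM; rewrite ?sum_weight// sumr_ge0// => i _; exact/ltW/weight_gt0.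
Qed.

(** This is the precise meaning of [A] being concentrated on [G]: its form is
    controlled by the seminorm [nrm (D x)], in which the coordinates outside [G]
    carry summable weights. *)
Lemma form_bound x y : nrm (dot (A x) y) <= (K + 8) * (nrm (D x) * nrm (D y)).
Proof.
(* The bound is first proved for truncated expansions, split along G. *)
have main M N : nrm (dot (A (\sum_(0 <= m < M) dot x (e m) *: e m))
    (\sum_(0 <= m < N) dot y (e m) *: e m)) <= (K + 8) * (nrm (D x) * nrm (D y)).
  rewrite [in X in dot (A X)](bigID G)/= [X in dot _ X](bigID G)/=.
  rewrite -/(low M x) -/(low N y) -/(high M x) -/(high N y).
  rewrite (linearD A) !(dotDl, dotDr).
  have pp : nrm (dot (A (low M x)) (low N y)) <= K * (nrm (D x) * nrm (D y)).
    rewrite (le_trans (CauchySchwarz_nrm Hdot _ _))// mulrA.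
    apply: ler_pM; rewrite ?nrm_ge0 ?low_le//.
    by rewrite (le_trans (AK _))// ler_wpM2l// low_le.
  have qp : nrm (dot (A (high M x)) (low N y)) <= 2 * (nrm (D x) * nrm (D y)).
    rewrite (le_trans (CauchySchwarz_nrm Hdot _ _))// mulrA.
    by apply: ler_pM; rewrite ?nrm_ge0 ?low_le ?high_le.
  have pq : nrm (dot (A (low M x)) (high N y)) <= 2 * (nrm (D x) * nrm (D y)).
    rewrite As (le_trans (CauchySchwarz_nrm Hdot _ _))// mulrCA.
    by apply: ler_pM; rewrite ?nrm_ge0 ?low_le ?high_le.
  have qq := high_high_le M N x y.
  set ll := dot (A (low M x)) (low N y) in pp *.
  set lh := dot (A (low M x)) (high N y) in pq *.
  set hl := dot (A (high M x)) (low N y) in qp *.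
  set hh := dot (A (high M x)) (high N y) in qq *.
  have := ler_nrmD (ll + lh) (hl + hh).
  have := ler_nrmD ll lh; have := ler_nrmD hl hh.
  move: pp qp pq qq; set dd := nrm (D x) * nrm (D y) => pp qp pq qq.
  have -> : (K + 8) * dd = K * dd + 8 * dd by ring.
  lra.
have h1 N : nrm (dot (A x) (\sum_(0 <= m < N) dot y (e m) *: e m)) <=
    (K + 8) * (nrm (D x) * nrm (D y)).
  have Ax : lim_to (fun M => A (\sum_(0 <= m < M) dot x (e m) *: e m)) (A x).
    apply: (lim_to_lip (K := K)) (expansion Hdot eb x) => u v.
    by rewrite -(raddfB A); exact: AK.
  exact: (lim_to_le (lim_to_dotl Hdot _ Ax)).
exact: (lim_to_le (lim_to_dotr Hdot _ (expansion Hdot eb y))).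
Qed.

Variables (J1 J2 : {linear H -> H}) (p1 p2 : nat -> nat).
Hypotheses (J1s : selfadj dot J1) (J2s : selfadj dot J2).
Hypotheses (J1E : forall x m, dot (J1 x) (e m) = dot x (e (p1 m))).
Hypotheses (J2E : forall x m, dot (J2 x) (e m) = dot x (e (p2 m))).
Hypotheses (J1K : forall x, J1 (J1 x) = x) (J2K : forall x, J2 (J2 x) = x).
Hypothesis orb_inj : forall m, injective (fun n => iter n (p2 \o p1) m).
Hypothesis G_inj : forall m m' n n', G m -> G m' ->
  iter n (p2 \o p1) m = iter n' (p2 \o p1) m' -> n = n' /\ m = m'.

Let W := J1 \o J2.
Let V := J2 \o J1.

Lemma iterWE n x m : dot (iter n W x) (e m) = dot x (e (iter n (p2 \o p1) m)).
Proof. by elim: n m => [//|n IH] m; rewrite iterS iterSr /W /= J1E J2E IH. Qed.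

Lemma iterV n x y : dot (iter n V x) y = dot x (iter n W y).
Proof. by elim: n y => [//|n IH] y; rewrite iterS iterSr /V /= J2s J1s IH. Qed.

(** Outside [G], each orbit of the shift is an orthonormal family, so Bessel
    bounds the contribution of every index by its weight, and the weights are
    summable. On [G], the orbits of different indices are disjoint and a
    single application of Bessel suffices. *)
Lemma orbit_sum N x : \sum_(0 <= n < N) nrm (D (iter n W x)) ^+ 2 <= 3 * nrm x ^+ 2.
Proof.
apply/ler_addgt0Pr => eps e0.
have [M /(_ _ (leqnn M)) hM] := parseval_sum (fun n => D (iter n W x)) N e0.
apply: le_trans hM _; rewrite lerD2r exchange_big/=.
have sq n m : nrm (dot (D (iter n W x)) (e m)) ^+ 2 =
    weight m ^+ 2 * nrm (dot x (e (iter n (p2 \o p1) m))) ^+ 2.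
  by rewrite DE iterWE nrmM nrm_real exprMn real_normK ?num_real.
rewrite (bigID G)/=.
have -> : 3 * nrm x ^+ 2 = nrm x ^+ 2 + 2 * nrm x ^+ 2 by ring.
apply: lerD.
  under eq_bigr => m Gm.
    under eq_bigr do rewrite sq /weight Gm expr1n mul1r.
    over.
  rewrite -big_filter.
  rewrite -(big_allpairs_dep (h := fun m n => iter n (p2 \o p1) m)
     (r2 := fun=> index_iota 0 N) (F := fun i => nrm (dot x (e i)) ^+ 2)).
  apply: (basis_bessel Hdot eb); apply: allpairs_uniq => [||[m n] [m' n']].
  - by rewrite filter_uniq ?iota_uniq.
  - exact: iota_uniq.
  - move=> /allpairsP[[a b] /= [ha _ [-> ->]]] /allpairsP[[a' b'] /= [ha' _ [-> ->]]].
    move: ha ha'; rewrite !mem_filter => /andP[Ga _] /andP[Ga' _].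
    by move=> /(G_inj Ga Ga') [-> ->].
apply: (@le_trans _ _ (\sum_(0 <= m < M | ~~ G m) weight m * nrm x ^+ 2)).
  apply: ler_sum => m _; under eq_bigr do rewrite sq.
  rewrite -mulr_sumr; apply: ler_pM.
  - exact: sqr_ge0.
  - by apply: sumr_ge0 => i _; exact: sqr_ge0.
  - have := weight_gt0 m; have := weight_le1 m; nra.
  - rewrite -(big_map (fun n => iter n (p2 \o p1) m) xpredT
      (fun i => nrm (dot x (e i)) ^+ 2)).
    by apply: (basis_bessel Hdot eb); rewrite map_inj_uniq ?iota_uniq.
by rewrite -mulr_suml ler_wpM2r ?sqr_ge0 ?sum_weight.
Qed.

Let S N x := \sum_(0 <= n < N) iter n V (A (iter n W x)).

(** Test the difference [d] of two partial sums against itself. By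
    [form_bound] each term is at most a product of two seminorms, split by the
    arithmetic-geometric inequality; [orbit_sum] lets the part that involves [d]
    be absorbed in the left-hand side. *)
Lemma partial_bound N M x : (N <= M)%N ->
  nrm (S M x - S N x) ^+ 2 <= 3 * (K + 8) ^+ 2 *
   (\sum_(0 <= n < M) nrm (D (iter n W x)) ^+ 2 -
    \sum_(0 <= n < N) nrm (D (iter n W x)) ^+ 2).
Proof.
move=> NM; rewrite /S !(big_cat_nat (leq0n N) NM)/= addrAC subrr add0r.
rewrite (addrAC (\sum_(0 <= n < N) nrm _ ^+ 2)) subrr add0r.
set d := \sum_(N <= n < M) _; set T := \sum_(N <= n < M) _.
set C := K + 8; have C0 : 0 < C by rewrite ltr_wpDl.
have Td : \sum_(N <= n < M) nrm (D (iter n W d)) ^+ 2 <= 3 * nrm d ^+ 2.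
  apply: le_trans (orbit_sum M d); rewrite [leRHS](big_cat_nat (leq0n N) NM)/=.
  by rewrite lerDr sumr_ge0// => i _; exact: sqr_ge0.
have dd : nrm d ^+ 2 = nrm (dot d d).
  by rewrite (dotxx Hdot) nrm_real ger0_norm ?sqr_ge0.
(* C a b <= 3 C^2 a^2 / 2 + b^2 / 6; the factor 1/6 makes the sum of the second
   terms at most half of |d|^2. *)
have : nrm (dot d d) <= \sum_(N <= n < M) (3 * C ^+ 2 / 2 * nrm (D (iter n W x)) ^+ 2
     + 6^-1 * nrm (D (iter n W d)) ^+ 2).
  rewrite {1}/d dot_suml (le_trans (ler_nrm_sum _ _ _))//.
  apply: ler_sum => n _; rewrite iterV (le_trans (form_bound _ _))// -/C.
  set a := nrm _; set b := nrm _.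
  have := sqr_ge0 (3 * C * a - b); lra.
rewrite big_split/= -!mulr_sumr -/T -dd; nra.
Qed.

(** [B] is the strong limit of the sums of [V^n A W^n] with [V = J2 J1] and
    [W = J1 J2] inverse to each other; conjugating by [V] shifts the sum by one
    term. *)
Lemma telescope : exists B : {linear H -> H},
  [/\ selfadj dot B, exists CB : R, bounded_by CB B &
      forall x, J2 (J1 (B (J1 (J2 x)))) = B x - A x].
Proof.
set C := K + 8; have C0 : 0 < C by rewrite ltr_wpDl.
have Smono x : {homo (fun N => \sum_(0 <= n < N) nrm (D (iter n W x)) ^+ 2) :
    m n / (m <= n)%N >-> m <= n}.
  move=> m n mn; rewrite [leRHS](big_cat_nat (leq0n m) mn)/= lerDl.
  by apply: sumr_ge0 => i _; exact: sqr_ge0.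
have Slim x : exists l, lim_to (fun N => S N x) l.
  apply: (cauchy_lim_to (v := fun N => S N x)) => eps e0.
  have q0 : 0 < eps ^+ 2 / (3 * C ^+ 2) by rewrite divr_gt0 ?mulr_gt0 ?exprn_gt0.
  have [N hN] := bounded_mono_cauchy (Smono x) (fun N => orbit_sum N x) q0.
  have h m n : (N <= n)%N -> (n <= m)%N -> nrm (S m x - S n x) <= eps.
    move=> Nn nm; rewrite -ler_sqr ?nnegrE ?nrm_ge0 ?(ltW e0)//.
    rewrite (le_trans (partial_bound _ nm))// mulrC -ler_pdivlMr ?mulr_gt0 ?exprn_gt0//.
    exact: hN.
  exists N => m n Nm Nn; have [mn|/ltnW nm] := leqP m n; last exact: h.
  by rewrite nrm_distC h.
have /choice[B hB] := Slim.
have Bs : selfadj dot B.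
  move=> x y; have h1 := lim_to_dotl Hdot y (hB x).
  have h2 := lim_to_dotr Hdot x (hB y).
  apply: (lim_to_uniq h1); apply: lim_to_ext h2 => N.
  rewrite /S dot_suml dot_sumr; apply: eq_bigr => n _.
  by rewrite iterV As (dotC dot x) iterV -dotC.
have [B' BB'] := selfadj_linear Hdot Bs; exists B'; split.
- by move=> x y; rewrite !BB'.
- exists (3 * C) => x; rewrite BB'; apply: (lim_to_sqr_le (hB x)).
    by rewrite mulr_ge0 ?nrm_ge0// ltW// mulr_gt0.
  move=> N; have := @partial_bound 0 N x isT; rewrite {2}/S !(big_geq (leqnn 0)) !subr0.
  move/le_trans; apply; rewrite -/C.
  have := orbit_sum N x; have := sqr_ge0 C; set s := \sum_(0 <= n < N) _.
  rewrite !exprMn; nra.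
- move=> x; rewrite !BB'.
  have h1 : lim_to (fun N => V (S N (W x))) (V (B (W x))).
    apply: (lim_to_lip (K := 1)) (hB (W x)) => u v.
    rewrite mul1r /V/= -(raddfB J2) -(raddfB J1).
    suff Jn (J : {linear H -> H}) : selfadj dot J -> (forall x, J (J x) = x) ->
        forall z, nrm (J z) = nrm z by rewrite !Jn.
    move=> Js JK z; apply/eqP; rewrite -(@eqrXn2 _ 2) ?nrm_ge0//; apply/eqP.
    by apply: (@complexI R); rewrite -!(dotxx Hdot) Js JK.
  apply: (lim_to_uniq h1).
  have h2 := lim_toD (lim_to_shift (hB x)) (lim_to_cst (- A x)).
  apply: lim_to_ext h2 => N; rewrite /S big_nat_recl//= addrAC subrr add0r.
  rewrite /V /= !linear_sum; apply: eq_bigr => n _.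
  by rewrite -iterS iterSr.
Qed.

End Telescope.

(** * Inverses, square roots and pairs of projections *)
Section Calculus.
Variables (R : realType) (H : completeNormedModType R[i]).
Variable (dot : {dot H for Num.conj}).
Hypothesis Hdot : induces_norm dot.
Implicit Types x y z : H.

Lemma geometric_lim (v : nat -> H) (K : R) :
  (forall n, nrm (v n.+1 - v n) <= K * 2^-1 ^+ n) -> exists l, lim_to v l.
Proof.
move=> vK; have K0 : 0 <= K.
  by have := vK 0%N; rewrite expr0 mulr1; apply: le_trans; exact: nrm_ge0.
pose S n := \sum_(0 <= i < n) K * 2^-1 ^+ i.
have Sm : {homo S : m n / (m <= n)%N >-> m <= n}.
  move=> m n mn; rewrite /S [leRHS](big_cat_nat (leq0n m) mn)/= lerDl.
  by apply: sumr_ge0 => i _; rewrite mulr_ge0// exprn_ge0// invr_ge0.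
have SK n : S n <= K * 2 by rewrite /S -mulr_sumr ler_wpM2l// geom_le2.
have h m n : (n <= m)%N -> nrm (v m - v n) <= S m - S n.
  elim: m => [|m IH]; first by rewrite leqn0 => /eqP ->; rewrite !subrr nrm0.
  rewrite leq_eqVlt => /predU1P[->|]; first by rewrite !subrr nrm0.
  rewrite ltnS => /IH {}IH; rewrite /S big_nat_recr//= -/(S m).
  have -> : v m.+1 - v n = (v m.+1 - v m) + (v m - v n) by rewrite subrKA.
  by rewrite (le_trans (ler_nrmD _ _))//; have := vK m; move: IH; rewrite /S; lra.
apply: cauchy_lim_to => eps e0; have [N hN] := bounded_mono_cauchy Sm SK e0.
exists N => m n Nm Nn; have [mn|/ltnW nm] := leqP m n.
  by rewrite nrm_distC (le_trans (h _ _ mn))// hN.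
by rewrite (le_trans (h _ _ nm))// hN.
Qed.

Lemma lim_to_dot v w l m : lim_to v l -> lim_to w m ->
  lim_to (fun n => dot (v n) (w n) : R[i]) (dot l m : R[i]).
Proof.
move=> vl wm e e0.
have [N1 h1] := lim_to_dotl Hdot m vl (divr_gt0 e0 (ltr0n R 3)).
have [N2 h2] := lim_to_dotr Hdot l wm (divr_gt0 e0 (ltr0n R 3)).
have [N3 h3] := vl _ (divr_gt0 e0 (ltr0n R 3)).
have [N4 h4] := wm _ (ltr01 : (0 : R) < 1).
exists (maxn (maxn N1 N2) (maxn N3 N4)) => n; rewrite !geq_max.
move=> /andP[/andP[/h1 {}h1 /h2 {}h2] /andP[/h3 {}h3 /h4 {}h4]].
have -> : dot (v n) (w n) - dot l m = dot (v n - l) (w n - m) +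
    ((dot (v n) m - dot l m) + (dot l (w n) - dot l m)).
  by rewrite !(dotDl, dotDr, dotNl, dotNr); ring.
have h5 : nrm (dot (v n - l) (w n - m)) <= e / 3 * 1.
  by rewrite (le_trans (CauchySchwarz_nrm Hdot _ _))// ler_pM ?nrm_ge0.
have := ler_nrmD (dot (v n - l) (w n - m))
  ((dot (v n) m - dot l m) + (dot l (w n) - dot l m)).
have := ler_nrmD (dot (v n) m - dot l m) (dot l (w n) - dot l m).
move: h1 h2 h5; lra.
Qed.

Lemma selfadjD f g : selfadj dot f -> selfadj dot g -> selfadj dot (fun x => f x + g x).
Proof. by move=> fs gs x y; rewrite dotDl dotDr fs gs. Qed.

Lemma selfadjZ (r : R) f : selfadj dot f -> selfadj dot (fun x => r%:C *: f x).
Proof. by move=> fs x y; rewrite dotZl dotZr fs conj_real. Qed.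

Lemma selfadjN f : selfadj dot f -> selfadj dot (fun x => - f x).
Proof. by move=> fs x y; rewrite dotNl dotNr fs. Qed.

Lemma selfadj_id : selfadj dot id.
Proof. by []. Qed.

Lemma selfadj_comp f g : selfadj dot f -> selfadj dot g ->
  (forall x, f (g x) = g (f x)) ->
  selfadj dot (fun x => f (g x)).
Proof. by move=> fs gs fg x y; rewrite fs gs fg. Qed.

Lemma selfadj_sqr f : selfadj dot f -> selfadj dot (fun x => f (f x)).
Proof. by move=> fs x y; rewrite !fs. Qed.

Lemma symmetry_isometry f x : selfadj dot f -> (forall x, f (f x) = x) ->
  nrm (f x) = nrm x.
Proof.
move=> fs fK; apply/eqP; rewrite -(@eqrXn2 _ 2) ?nrm_ge0//; apply/eqP.
by apply: (@complexI R); rewrite -!(dotxx Hdot) fs fK.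
Qed.

(** [C = 1 - L], where [L] is the fixed point of [Y |-> (M + Y^2) / 2], reached by
    iteration from 0. The iterates are polynomials in [M], whence the
    commutation. *)
Lemma sqrt_one_sub (M : {linear H -> H}) : selfadj dot M -> bounded_by 4^-1 M ->
  exists C : {linear H -> H}, [/\ selfadj dot C, forall x, C (C x) = x - M x &
    forall (F : {linear H -> H}) KF, bounded_by KF F -> (forall x, F (M x) = M (F x)) ->
      forall x, F (C x) = C (F x)].
Proof.
move=> Ms MK.
have half : 2^-1 + 2^-1 = 1 :> R by field.
pose Y := fix Y n := if n is m.+1 then fun x => 2^-1%:C *: (M x + Y m (Y m x))
  else fun=> 0 : H.
have Ys n : selfadj dot (Y n).
  elim: n => [x y|n IH]; first by rewrite /= linear0l linear0r.
  exact/selfadjZ/selfadjD/selfadj_sqr.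
have Ylin n x y : Y n x - Y n y = Y n (x - y).
  have [Y' YY] := selfadj_linear Hdot (Ys n).
  by rewrite -!YY raddfB.
have YK n : bounded_by 4^-1 (Y n).
  elim: n => [x|n IH x]; first by rewrite /= nrm0 mulr_ge0 ?nrm_ge0// invr_ge0.
  rewrite /= nrmZr ger0_norm ?invr_ge0//.
  have := ler_nrmD (M x) (Y n (Y n x)); have := MK x; have := IH x.
  have := IH (Y n x); have := nrm_ge0 x; lra.
have Yd n x : nrm (Y n.+1 x - Y n x) <= nrm x * 2^-1 ^+ n.
  elim: n x => [|n IH] x.
    rewrite /= subr0 addr0 expr0 mulr1 nrmZr ger0_norm ?invr_ge0//.
    have := MK x; have := nrm_ge0 x; lra.
  have -> : Y n.+2 x - Y n.+1 x = 2^-1%:C *: (Y n.+1 (Y n.+1 x - Y n x) +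
      (Y n.+1 (Y n x) - Y n (Y n x))).
    rewrite -Ylin subrKA /=.
    by rewrite -scalerBr opprD addrACA subrr add0r.
  rewrite nrmZr ger0_norm ?invr_ge0// exprS.
  have := ler_nrmD (Y n.+1 (Y n.+1 x - Y n x)) (Y n.+1 (Y n x) - Y n (Y n x)).
  have := YK n.+1 (Y n.+1 x - Y n x); have := IH x; have := IH (Y n x).
  have := YK n x; have p0 : 0 <= (2^-1 : R) ^+ n by rewrite exprn_ge0// invr_ge0.
  move=> h1 h2 h3 h4 h5.
  have : nrm (Y n x) * 2^-1 ^+ n <= 4^-1 * nrm x * 2^-1 ^+ n by rewrite ler_wpM2r.
  have := mulr_ge0 (nrm_ge0 x) p0; lra.
have /choice[L hL] x : exists l, lim_to (fun n => Y n x) l.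
  exact: (geometric_lim (fun n => Yd n x)).
have Ls : selfadj dot L.
  move=> x y; apply: (lim_to_uniq (lim_to_dotl Hdot y (hL x))).
  by apply: lim_to_ext (lim_to_dotr Hdot x (hL y)) => n; rewrite Ys.
have LE x : L x + L x = M x + L (L x).
  apply: (dot_ext Hdot) => y; rewrite !dotDl.
  have h1 := lim_to_dotl Hdot y (lim_to_shift (hL x)).
  apply: (lim_to_uniq (lim_toD h1 h1)).
  have h2 := lim_toD (lim_to_cst (dot (M x) y : R[i])) (lim_to_dot (hL x) (hL y)).
  rewrite -Ls in h2; apply: lim_to_ext h2 => n; rewrite /= dotZl dotDl !Ys -mulrDl.
  by rewrite -rmorphD/= half mul1r.
have [C CE] : exists C : {linear H -> H}, C =1 (fun x => x - L x).
  apply: (selfadj_linear Hdot).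
  by apply: selfadjD; [exact: selfadj_id | exact: selfadjN].
have [L' LL] := selfadj_linear Hdot Ls.
exists C; split.
- by move=> x y; rewrite !CE !(dotDl, dotDr, dotNl, dotNr) Ls.
- move=> x; have LB u v : L (u - v) = L u - L v by rewrite -!LL; exact: raddfB.
  have -> : M x = L x + L x - L (L x) by rewrite LE addrK.
  by rewrite !CE LB; dot_ring Hdot.
- move=> F KF FK FM x; rewrite !CE raddfB; congr (_ - _).
  have FL : lim_to (fun n => F (Y n x)) (F (L x)).
    by apply: (lim_to_lip (K := KF)) (hL x) => u v; rewrite -(raddfB F); exact: FK.
  apply: (lim_to_uniq FL); apply: lim_to_ext (hL (F x)) => n.
  elim: n x {FL} => [|n IH] x /=; rewrite ?raddf0//.
  by rewrite (linearZ_LR F)/= (linearD F) !IH FM.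
Qed.

(** The equation [Z r + E r = x] amounts to [r = Z x - Z (E r)], a contraction
    with factor 1/2. Self-adjointness of [Z + E] turns the right inverse thus
    obtained into a two-sided one. *)
Lemma perturbed_symmetry_inv (Z E : {linear H -> H}) : selfadj dot Z -> selfadj dot E ->
  (forall x, Z (Z x) = x) -> bounded_by 2^-1 E ->
  exists I : {linear H -> H}, [/\ selfadj dot I, bounded_by 2 I,
    forall x, Z (I x) + E (I x) = x & forall x, I (Z x + E x) = x].
Proof.
move=> Zs Es ZK EK.
pose r x := fix r n := if n is m.+1 then Z x - Z (E (r m)) else 0 : H.
have rd x n : nrm (r x n.+1 - r x n) <= nrm x * 2^-1 ^+ n.
  elim: n => [|n IH].
    by rewrite /= subr0 raddf0 raddf0 subr0 expr0 mulr1 symmetry_isometry.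
  have -> : r x n.+2 - r x n.+1 = - Z (E (r x n.+1 - r x n)).
    by rewrite (raddfB E) (raddfB Z) opprB [LHS]/= addrC opprB addrA subrK.
  rewrite nrmN symmetry_isometry// (le_trans (EK _))// exprS mulrCA.
  by rewrite ler_wpM2l// invr_ge0.
have /choice[L hL] x : exists l, lim_to (r x) l.
  exact: (geometric_lim (rd x)).
have LE x : Z (L x) + E (L x) = x.
  have h1 := lim_to_shift (hL x).
  suff h : L x = Z x - Z (E (L x)) by rewrite {1}h (linearB Z) !ZK subrK.
  apply: (lim_to_uniq h1).
  apply: (lim_to_lip (f := fun u => Z x - Z (E u)) (K := 2^-1)) (hL x) => u v.
  rewrite opprB addrC addrA subrK -(raddfB Z) -(raddfB E) symmetry_isometry//.
  by rewrite (nrm_distC u); exact: EK.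
have Ls : selfadj dot L.
  move=> x y; rewrite -[y in LHS]LE -[x in RHS]LE !(dotDl, dotDr) Zs Es.
  by [].
have [I IE] := selfadj_linear Hdot Ls.
exists I; split.
- by move=> x y; rewrite !IE.
- move=> x; rewrite IE; have := ler_nrm_dist (Z (L x)) (- E (L x)).
  rewrite opprK LE nrmN symmetry_isometry//; have := EK (L x); lra.
- by move=> x; rewrite IE LE.
- move=> x; apply: (dot_ext Hdot) => y.
  by rewrite !IE Ls dotDl Zs Es -dotDr LE.
Qed.

(** Boundedness is automatic: [|P x|^2 = <P x, x> <= |P x| |x|]. *)
Lemma orthoprojectionI (P : {linear H -> H}) : selfadj dot P ->
  (forall x, P (P x) = P x) ->
  orthoprojection dot P.
Proof.
move=> Ps PP; split=> //; exists 1 => x; rewrite mul1r !nrmE lecR.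
have [->|/eqP/nrm_gt0 px] := eqVneq (P x) 0; first by rewrite nrm0 nrm_ge0.
rewrite -(ler_pM2l px) -expr2 -[leLHS]ger0_norm ?sqr_ge0// -nrm_real -(dotxx Hdot).
by rewrite Ps PP (le_trans (CauchySchwarz_nrm Hdot _ _))// mulrC.
Qed.

Lemma symmetry_orthoproj (U : H -> H) : selfadj dot U -> (forall x, U (U x) = x) ->
  exists P : {linear H -> H}, orthoprojection dot P /\
    forall x, P x = 2^-1%:C *: (x + U x).
Proof.
move=> Us UK; have [U' UU] := selfadj_linear Hdot Us.
have half : 2^-1%:C + 2^-1%:C = 1 :> R[i].
  by rewrite -rmorphD/= (_ : 2^-1 + 2^-1 = 1)//; field.
have [P PE] : exists P : {linear H -> H}, P =1 fun x => 2^-1%:C *: (x + U x).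
  by apply: (selfadj_linear Hdot); apply/selfadjZ/selfadjD => //; exact: selfadj_id.
exists P; split=> //; apply: orthoprojectionI.
  by move=> x y; rewrite !PE dotZl dotZr conj_real dotDl dotDr Us.
move=> x; rewrite !PE -!UU (linearZ_LR U')/= (linearD U') !UU UK.
by rewrite [U x + x]addrC -scalerDl half scale1r.
Qed.

(** Away from [ep = 0], [G] is [ep * ka] times the inverse of [X]; for [ep = 0]
    one takes [G = 0]. Put [a = ep + ka], [b = ep - ka], [N = (X + G) / a] and
    [C = sqrt (1 - N^2)]. Since [J] commutes with [C] and anticommutes with [X]
    and [G], the operators [U1 = N + J C] and [U2 = (X - G - a J C) / b] square to
    1: for [U2] this is [(X - G)^2 = (X + G)^2 - 4 ep ka] together with
    [a^2 - 4 ep ka = b^2]. Finally [a U1 + b U2 = 2 X] and [a + b = 2 ep], so the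
    projections [(1 + U1) / 2] and [(1 + U2) / 2] are as desired. *)
Lemma two_projections (X G J : {linear H -> H}) (ep ka KX KG : R) :
  selfadj dot X -> selfadj dot G -> selfadj dot J -> (forall x, J (J x) = x) ->
  bounded_by KX X -> bounded_by KG G ->
  (forall x, X (J x) = - J (X x)) -> (forall x, G (J x) = - J (G x)) ->
  (forall x, X (G x) = (ep * ka)%:C *: x) ->
  (forall x, G (X x) = (ep * ka)%:C *: x) ->
  `|ep| < ka -> (forall x, nrm (X x + G x) <= (ep + ka) / 2 * nrm x) ->
  exists P Q : {linear H -> H}, [/\ orthoprojection dot P, orthoprojection dot Q &
    forall x, ep%:C *: x + X x = (ep + ka)%:C *: P x + (ep - ka)%:C *: Q x].
Proof.
move=> Xs Gs Js JK XK GK XJ GJ XG GX.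
rewrite ltr_norml => /andP[ek1 ek2] XGb.
pose a := ep + ka; pose b := ep - ka.
have a0 : 0 < a by rewrite /a; lra.
have b0 : b < 0 by rewrite /b; lra.
have Ns : selfadj dot (fun x => a^-1%:C *: (X x + G x)) by exact/selfadjZ/selfadjD.
have [N NE] := selfadj_linear Hdot Ns.
have [M ME] := selfadj_linear Hdot (selfadj_sqr Ns).
have MN x : M x = N (N x) by rewrite ME !NE.
have NK : bounded_by 2^-1 N.
  move=> x; rewrite NE nrmZr ger0_norm ?invr_ge0 ?(ltW a0)// mulrC ler_pdivrMr//.
  by rewrite (le_trans (XGb x))// -/a le_eqVlt; apply/orP; left; apply/eqP; field.
have MK : bounded_by 4^-1 M.
  move=> x; rewrite MN (le_trans (NK _))//.
  have := NK x; lra.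
have XN x : X (N x) = N (X x).
  by rewrite !NE (linearZ_LR X)/= (linearD X) XG GX.
have GN x : G (N x) = N (G x).
  by rewrite !NE (linearZ_LR G)/= (linearD G) XG GX.
have NJ x : N (J x) = - J (N x).
  by rewrite !NE XJ GJ (linearZ_LR J)/= (linearD J) -opprD scalerN.
have [C [Cs CC Ccomm]] : exists C : {linear H -> H}, [/\ selfadj dot C,
    forall x, C (C x) = x - M x &
    forall (F : {linear H -> H}) KF, bounded_by KF F -> (forall x, F (M x) = M (F x)) ->
      forall x, F (C x) = C (F x)].
  by apply: sqrt_one_sub => // x y; rewrite !MN !NE Ns Ns.
have XC : forall x, X (C x) = C (X x).
  by apply: (Ccomm X _ XK) => x; rewrite !MN !XN.
have GC : forall x, G (C x) = C (G x).
  by apply: (Ccomm G _ GK) => x; rewrite !MN !GN.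
have NC : forall x, N (C x) = C (N x).
  by apply: (Ccomm N _ NK) => x; rewrite !MN.
have JC : forall x, J (C x) = C (J x).
  apply: (Ccomm J 1) => [x|x]; first by rewrite mul1r symmetry_isometry.
  by rewrite !MN NJ (linearN N) NJ opprK.
have JCs : selfadj dot (fun x => J (C x)) by exact: selfadj_comp.
have aa : a%:C * a^-1%:C = 1 :> R[i] by rewrite -rmorphM/= mulfV// gt_eqF.
have bb : b%:C * b^-1%:C = 1 :> R[i] by rewrite -rmorphM/= mulfV// lt_eqF.
have JCJC x : J (C (J (C x))) = x - M x by rewrite -JC JK CC.
have U1K x : N (N x + J (C x)) + J (C (N x + J (C x))) = x.
  by rewrite (linearD N) (linearD C) (linearD J) JCJC NJ NC -MN; dot_ring Hdot.
have U1s : selfadj dot (fun x => N x + J (C x)).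
  by apply: selfadjD => // x y; rewrite !NE Ns.
have [P [Pp PE]] := symmetry_orthoproj U1s U1K.
pose U2 x := b^-1%:C *: (X x - G x - a%:C *: J (C x)).
have U2s : selfadj dot U2.
  by apply/selfadjZ/selfadjD; [apply/selfadjD/selfadjN | apply/selfadjN/selfadjZ].
have [U2' U2E] := selfadj_linear Hdot U2s.
have aN x : X x + G x = a%:C *: N x by rewrite NE scalerA aa scale1r.
have MaE x : (a ^+ 2)%:C *: M x = X (X x) + G (G x) + (2 * (ep * ka))%:C *: x.
  have -> : (a ^+ 2)%:C *: M x = a%:C *: (X (N x) + G (N x)).
    by rewrite aN MN scalerA -rmorphM.
  have -> : a%:C *: (X (N x) + G (N x)) = X (a%:C *: N x) + G (a%:C *: N x).
    by rewrite (linearZ_LR X)/= (linearZ_LR G)/= scalerDr.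
  rewrite -aN (linearD X) (linearD G) XG GX.
  by rewrite (_ : 2 * (ep * ka) = ep * ka + ep * ka) ?rmorphD/=; [dot_ring Hdot | ring].
have a2 : (a ^+ 2)%:C = a%:C * a%:C :> R[i] by rewrite -rmorphM.
have bi2 : (b^-1 * b^-1)%:C = b^-1%:C * b^-1%:C :> R[i] by rewrite -rmorphM.
have ekD : (2 * (ep * ka))%:C = (ep * ka)%:C + (ep * ka)%:C :> R[i].
  by rewrite -rmorphD/= -mulr2n mulr_natl.
have half : 2^-1%:C + 2^-1%:C = 1 :> R[i].
  by rewrite -rmorphD/= (_ : 2^-1 + 2^-1 = 1)//; field.
have epE : ep%:C = 2^-1%:C * (a%:C + b%:C) :> R[i].
  by rewrite -rmorphD -rmorphM/=; congr (_%:C); rewrite /a/b; field.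
have U2K x : U2 (U2 x) = x.
  have -> : U2 (U2 x) = (b^-1 * b^-1)%:C *: (X (X x) + G (G x) -
      (2 * (ep * ka))%:C *: x + (a ^+ 2)%:C *: x - (a ^+ 2)%:C *: M x).
    rewrite /U2 (linearZ_LR X)/= (linearZ_LR G)/= (linearZ_LR C)/= (linearZ_LR J)/=.
    rewrite !(linearB X) !(linearB G) !(linearB C) !(linearB J).
    rewrite (linearZ_LR X)/= (linearZ_LR G)/= (linearZ_LR C)/= (linearZ_LR J)/=.
    rewrite JCJC XG GX XJ GJ XC GC a2 ekD bi2; dot_ring Hdot.
  rewrite MaE.
  have -> : X (X x) + G (G x) - (2 * (ep * ka))%:C *: x + (a ^+ 2)%:C *: x -
    (X (X x) + G (G x) + (2 * (ep * ka))%:C *: x) = (b ^+ 2)%:C *: x.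
    have -> : b ^+ 2 = a ^+ 2 - 2 * (ep * ka) - 2 * (ep * ka) by rewrite /a/b; ring.
    by rewrite !rmorphB/=; dot_ring Hdot.
  rewrite scalerA -rmorphM/= (_ : b^-1 * b^-1 * b ^+ 2 = 1) ?scale1r//.
  by field; rewrite lt_eqF.
have [Q [Qp QE]] := symmetry_orthoproj U2s U2K.
exists P, Q; split=> // x; rewrite PE QE -/a -/b.
have bU : b%:C *: U2 x = X x - G x - a%:C *: J (C x).
  by rewrite /U2 scalerA bb scale1r.
have -> : a%:C *: (2^-1%:C *: (x + (N x + J (C x)))) =
    2^-1%:C *: (a%:C *: x + (X x + G x) + a%:C *: J (C x)) by rewrite aN; dot_ring Hdot.
have -> : b%:C *: (2^-1%:C *: (x + U2 x)) =
    2^-1%:C *: (b%:C *: x + (X x - G x - a%:C *: J (C x))).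
  by rewrite -bU; dot_ring Hdot.
by rewrite epE -[X x in LHS]scale1r -half; dot_ring Hdot.
Qed.
End Calculus.

(** * Self-adjoint operators *)
Section Main.
Variables (R : realType) (H : completeNormedModType R[i]).
Variable (dot : {dot H for Num.conj}).
Hypothesis Hdot : induces_norm dot.
Hypothesis Hsep : separable H.
Hypothesis Hinf : infinite_dimensional H.
Implicit Types x y z : H.

Lemma bounded_byD f g Kf Kg : bounded_by Kf f -> bounded_by Kg g ->
  bounded_by (Kf + Kg) (fun x => f x + g x : H).
Proof.
by move=> fK gK x; rewrite (le_trans (ler_nrmD _ _))// mulrDl lerD.
Qed.

Lemma bounded_byZ (r : R) f K : bounded_by K f ->
  bounded_by (`|r| * K) (fun x => r%:C *: f x : H).
Proof. by move=> fK x; rewrite nrmZr -mulrA ler_wpM2l. Qed.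

Lemma bounded_byN f K : bounded_by K f -> bounded_by K (fun x => - f x : H).
Proof. by move=> fK x; rewrite nrmN. Qed.

(** [X1 = B - J1 B J1] anticommutes with [J1] by its form. The telescoping
    identity for [B] rewrites [X2 = A - lam - X1] as
    [J1 B J1 - J2 (J1 B J1) J2], which has the same form for [J2]. The symmetry [Z]
    is the parity of the level, reversed by both matchings. *)
Lemma selfadjoint_split (A : {linear H -> H}) (KA : R) :
  selfadj dot A -> bounded_by KA A ->
  exists (lam : R) (J1 J2 Z X1 X2 : {linear H -> H}) (K : R),
  [/\ [/\ selfadj dot J1, selfadj dot J2, selfadj dot Z, selfadj dot X1 &
          selfadj dot X2],
      [/\ forall x, J1 (J1 x) = x, forall x, J2 (J2 x) = x &
          forall x, Z (Z x) = x],
      [/\ forall x, Z (J1 x) = - J1 (Z x), forall x, Z (J2 x) = - J2 (Z x),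
          forall x, X1 (J1 x) = - J1 (X1 x) & forall x, X2 (J2 x) = - J2 (X2 x)],
      [/\ 0 <= K, bounded_by K X1 & bounded_by K X2] &
      forall x, A x = lam%:C *: x + (X1 x + X2 x)].
Proof.
move=> As AK.
have [lam lamP] := approximate_eigenvalue Hdot Hinf As AK.
have [A' A'E] : exists A' : {linear H -> H}, A' =1 fun x => A x - lam%:C *: x.
  by apply: (selfadj_linear Hdot); apply/selfadjD/selfadjN/selfadjZ/selfadj_id.
have A's : selfadj dot A'.
  by move=> x y; rewrite !A'E !(dotDl, dotDr, dotNl, dotNr, dotZl, dotZr) As conj_real.
pose K := `|KA| + `|lam|.
have K0 : 0 <= K by rewrite addr_ge0.
have A'K : bounded_by K A'.
  move=> x; rewrite A'E (le_trans (ler_nrmB _ _))// nrmZr mulrDl lerD2r.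
  by rewrite (le_trans (AK x))// ler_wpM2r ?nrm_ge0// ler_norm.
have [p1 [p2 [s [G [cap [[p1K p2K sp1 sp2] orb Ginj capP]]]]]] := dihedral_index.
have [e [eb eA]] : exists e : nat -> H, orthonormal_basis dot e /\
    forall m, ~~ G m -> nrm (A' (e m)) <= weight R G m ^+ 4.
  apply: (adapted_basis Hdot Hsep Hinf (cap := cap)) => //.
    move=> eps F /lamP - /(_ F)[x [x1 xF xA]].
    by exists x; split=> //; rewrite A'E.
  by move=> m; rewrite exprn_gt0// weight_gt0.
have one1 m : `|(fun=> 1 : R) (m : nat)| <= 1 by rewrite normr1.
have [J1 [J1s _ J1E']] := weighted_perm Hdot eb p1K one1 (fun=> erefl).
have [J2 [J2s _ J2E']] := weighted_perm Hdot eb p2K one1 (fun=> erefl).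
have J1E x m : dot (J1 x) (e m) = dot x (e (p1 m)) by rewrite J1E' mul1r.
have J2E x m : dot (J2 x) (e m) = dot x (e (p2 m)) by rewrite J2E' mul1r.
have J1K x : J1 (J1 x) = x by apply: (basis_ext eb) => m; rewrite !J1E p1K.
have J2K x : J2 (J2 x) = x by apply: (basis_ext eb) => m; rewrite !J2E p2K.
pose sg m : R := if s m then 1 else - 1.
have sg1 m : `|sg m| <= 1 by rewrite /sg; case: ifP; rewrite ?normrN normr1.
have [Z [Zs _ ZE]] := weighted_perm Hdot eb (p := id) (fun=> erefl) sg1 (fun=> erefl).
have w1 m : `|weight R G m| <= 1.
  by rewrite ger0_norm ?weight_le1// ltW// weight_gt0.
have [D [_ _ DE]] := weighted_perm Hdot eb (p := id) (fun=> erefl) w1 (fun=> erefl).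
have ZK x : Z (Z x) = x.
  apply: (basis_ext eb) => m; rewrite !ZE mulrA -rmorphM/= /sg.
  by case: (s m); rewrite ?mulrNN mulr1 mul1r.
have sgN p : (forall m, s (p m) = ~~ s m) -> forall m, sg (p m) = - sg m.
  by move=> sp m; rewrite /sg sp; case: (s m) => /=; rewrite ?opprK.
have ZJ1 x : Z (J1 x) = - J1 (Z x).
  apply: (basis_ext eb) => m.
  by rewrite dotNl J1E !ZE J1E (sgN _ sp1) rmorphN mulNr opprK.
have ZJ2 x : Z (J2 x) = - J2 (Z x).
  apply: (basis_ext eb) => m.
  by rewrite dotNl J2E !ZE J2E (sgN _ sp2) rmorphN mulNr opprK.
have [B [Bs [CB BK] BE]] := telescope Hdot eb A's A'K K0 eA DE J1s J2s J1E J2E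
  J1K J2K orb Ginj.
have JBs (J C : {linear H -> H}) :
    selfadj dot J -> selfadj dot C -> selfadj dot (fun x => J (C (J x))).
  by move=> Js Cs x y; rewrite Js Cs Js.
have [X1 X1E] : exists X : {linear H -> H}, X =1 fun x => B x - J1 (B (J1 x)).
  by apply: (selfadj_linear Hdot); apply/selfadjD/selfadjN/JBs.
have [X2 X2E] : exists X : {linear H -> H}, X =1 fun x => A' x - X1 x.
  apply: (selfadj_linear Hdot); apply/selfadjD/selfadjN => //.
  by move=> x y; rewrite !X1E dotDl dotDr dotNl dotNr Bs J1s Bs J1s.
have X2E' x : X2 x = J1 (B (J1 x)) - J2 (J1 (B (J1 (J2 x)))).
  by rewrite X2E X1E BE; dot_ring Hdot.
have X1s : selfadj dot X1.
  by move=> x y; rewrite !X1E dotDl dotDr dotNl dotNr Bs J1s Bs J1s.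
have X2s : selfadj dot X2.
  by move=> x y; rewrite !X2E dotDl dotDr dotNl dotNr A's X1s.
have X1K : bounded_by (`|CB| + `|CB|) X1.
  have BK' : bounded_by `|CB| B.
    by move=> x; rewrite (le_trans (BK x))// ler_wpM2r ?nrm_ge0// ler_norm.
  suff JBK : bounded_by `|CB| (fun x => J1 (B (J1 x))).
    by move=> x; rewrite X1E; exact: (bounded_byD BK' (bounded_byN JBK)).
  move=> x; rewrite (symmetry_isometry Hdot)// (le_trans (BK' _))//.
  by rewrite (symmetry_isometry Hdot).
exists lam, J1, J2, Z, X1, X2, (K + (`|CB| + `|CB|)); split => //.
- split=> // x.
    by rewrite !X1E J1K (linearB J1) J1K opprB.
  by rewrite !X2E' J2K (linearB J2) J2K opprB.
- split; first by rewrite !addr_ge0.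
    by move=> x; rewrite (le_trans (X1K x))// ler_wpM2r ?nrm_ge0// lerDr.
  by move=> x; rewrite X2E; exact: (bounded_byD A'K (bounded_byN X1K)).
- by move=> x; rewrite X2E A'E; dot_ring Hdot.
Qed.

(** [A - lam = (X1 + c Z) + (X2 - c Z)]. For large [c] the first summand is
    [c (Z + E)] with [E] of norm at most 1/2, hence invertible with a lower bound
    that is a large multiple of [|lam|]; its pair of projections absorbs the
    scalar [lam]. The second summand needs a pair with opposite coefficients only. *)
Lemma selfadjoint_four_projections (A : {linear H -> H}) (KA : R) :
  selfadj dot A -> bounded_by KA A ->
  exists (a b c d : R) (P Q P' Q' : {linear H -> H}),
    [/\ orthoprojection dot P, orthoprojection dot Q,
        orthoprojection dot P', orthoprojection dot Q' &
        forall x, A x = a%:C *: P x + b%:C *: Q x + (c%:C *: P' x + d%:C *: Q' x)].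
Proof.
move=> As AK.
have [lam [J1 [J2 [Z [X1 [X2 [K [[J1s J2s Zs X1s X2s] [J1K J2K ZK] [ZJ1 ZJ2 XJ1 XJ2]
  [K0 X1K X2K] AE]]]]]]]] := selfadjoint_split As AK.
(* Then X1 / c has norm at most 1/2, and 16 |lam| <= c. *)
pose c := 2 * K + 16 * `|lam| + 1.
have l0 := normr_ge0 lam.
have c0 : 0 < c by rewrite /c; lra.
have ZK1 : bounded_by 1 Z by move=> x; rewrite mul1r (symmetry_isometry Hdot).
have [E EE] := selfadj_linear Hdot (selfadjZ c^-1 X1s).
have Es : selfadj dot E by move=> x y; rewrite !EE; exact: selfadjZ.
have EK : bounded_by 2^-1 E.
  move=> x; rewrite EE nrmZr ger0_norm ?invr_ge0 ?(ltW c0)// mulrC ler_pdivrMr//.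
  have := X1K x; have := nrm_ge0 x; rewrite /c; nra.
have [I [Is IK XI IX]] := perturbed_symmetry_inv Hdot Zs Es ZK EK.
(* With ka = 8 c, the operator G = 8 lam I is lam * ka times the inverse of
   X = c (Z + E). *)
have [X XE] := selfadj_linear Hdot (selfadjD X1s (selfadjZ c Zs)).
have Xs : selfadj dot X.
  by move=> x y; rewrite !XE; exact: (selfadjD X1s (selfadjZ c Zs)).
have cc : c%:C * c^-1%:C = 1 :> R[i] by rewrite -rmorphM/= mulfV// gt_eqF.
have XE' x : X x = c%:C *: (Z x + E x).
  by rewrite XE EE scalerDr scalerA cc scale1r addrC.
have [G GE] := selfadj_linear Hdot (selfadjZ (8 * lam) Is).
have Gs : selfadj dot G by move=> x y; rewrite !GE; exact: selfadjZ.
have IJ x : I (J1 x) = - J1 (I x).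
  have -> : J1 x = Z (- J1 (I x)) + E (- J1 (I x)).
    rewrite -{1}(XI x) (linearN Z) (linearN E) ZJ1 !EE XJ1 (linearD J1).
    by rewrite (linearZ_LR J1) scalerN !opprK.
  exact: IX.
have XK : bounded_by (K + `|c| * 1) X.
  by move=> x; rewrite XE; exact: (bounded_byD X1K (bounded_byZ c ZK1) x).
have GK : bounded_by (`|8 * lam| * 2) G by move=> x; rewrite GE; exact: bounded_byZ.
have GKl x : nrm (G x) <= 16 * `|lam| * nrm x.
  have := GK x; rewrite normrM (ger0_norm (_ : 0 <= 8))//.
  by have -> : 8 * `|lam| * 2 = 16 * `|lam| by ring.
have XKc x : nrm (X x) <= (K + c) * nrm x.
  by have := XK x; rewrite mulr1 (gtr0_norm c0).
have lc : (lam * (8 * c))%:C = (8 * lam)%:C * c%:C :> R[i].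
  by rewrite -rmorphM/= mulrCA mulrA.
have XJ x : X (J1 x) = - J1 (X x).
  rewrite !XE XJ1 ZJ1 (linearD J1) (linearZ_LR J1)/=.
  by rewrite scalerN -opprD.
have GJ x : G (J1 x) = - J1 (G x).
  by rewrite !GE IJ scalerN (linearZ_LR J1).
have XG x : X (G x) = (lam * (8 * c))%:C *: x.
  by rewrite GE (linearZ_LR X)/= XE' XI scalerA lc.
have GX x : G (X x) = (lam * (8 * c))%:C *: x.
  by rewrite GE XE' (linearZ_LR I)/= IX scalerA lc.
have lamc : `|lam| < 8 * c by rewrite /c; lra.
have XGb x : nrm (X x + G x) <= (lam + 8 * c) / 2 * nrm x.
  have := ler_nrmD (X x) (G x); have := GKl x; have := XKc x.
  have := nrm_ge0 x; have := ler_norm (- lam); rewrite normrN /c; nra.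
have [P [Q [Pp Qp PQ]]] :=
  two_projections Hdot Xs Gs J1s J1K XK GK XJ GJ XG GX lamc XGb.
have [X' X'E] := selfadj_linear Hdot (selfadjD X2s (selfadjN (selfadjZ c Zs))).
have X's : selfadj dot X'.
  by move=> x y; rewrite !X'E; exact: (selfadjD X2s (selfadjN (selfadjZ c Zs))).
have X'K : bounded_by (K + `|c| * 1) X'.
  move=> x; rewrite X'E.
  exact: (bounded_byD X2K (bounded_byN (bounded_byZ c ZK1)) x).
have zs : selfadj dot (fun=> 0 : H) by move=> x y; rewrite linear0l linear0r.
have [O OE] := selfadj_linear Hdot zs.
have Os : selfadj dot O by move=> x y; rewrite !OE; exact: zs.
have OK : bounded_by 0 O by move=> x; rewrite OE nrm0 mul0r.
have X'J x : X' (J2 x) = - J2 (X' x).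
  rewrite !X'E XJ2 ZJ2 (linearD J2) (linearN J2) (linearZ_LR J2)/=.
  by rewrite scalerN -opprD.
have OJ x : O (J2 x) = - J2 (O x) by rewrite !OE linear0 oppr0.
have XO x : X' (O x) = (0 * (2 * (K + c)))%:C *: x.
  by rewrite !OE linear0 mul0r scale0r.
have OX x : O (X' x) = (0 * (2 * (K + c)))%:C *: x.
  by rewrite !OE mul0r scale0r.
have K2 : `|0 : R| < 2 * (K + c) by rewrite normr0; lra.
have XOb x : nrm (X' x + O x) <= (0 + 2 * (K + c)) / 2 * nrm x.
  rewrite OE addr0 add0r; have := X'K x; rewrite mulr1 (gtr0_norm c0).
  by have -> : 2 * (K + c) / 2 = K + c by field.
have [P' [Q' [P'p Q'p PQ']]] :=
  two_projections Hdot X's Os J2s J2K X'K OK X'J OJ XO OX K2 XOb.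
exists (lam + 8 * c), (lam - 8 * c), (0 + 2 * (K + c)), (0 - 2 * (K + c)), P, Q, P', Q'.
split=> // x; rewrite -PQ -PQ' AE XE X'E scale0r.
by rewrite add0r -addrA; congr (_ + _); dot_ring Hdot.
Qed.

End Main.

(** * The cartesian decomposition *)
Section Adjoint.
Variables (R : realType) (H : completeNormedModType R[i]).
Variable (dot : {dot H for Num.conj}).
Hypothesis Hdot : induces_norm dot.
Hypothesis Hsep : separable H.
Hypothesis Hinf : infinite_dimensional H.
Implicit Types x y z : H.

Lemma bounded_operator_real (T : {linear H -> H}) :
  bounded_operator T -> exists K : R, bounded_by K T.
Proof.
move=> [M TM]; exists (complex.Re M) => x; have := TM x.
rewrite !nrmE lecE => /andP[_] /=; case: M {TM} => a b /=.
by rewrite mulr0 subr0.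
Qed.

Lemma orthonormal_basis_exists : exists e : nat -> H, orthonormal_basis dot e.
Proof.
have [|m|k|e [eb _]] := adapted_basis Hdot Hsep Hinf (A := fun=> 0)
    (th := fun=> 1) (G := xpredT) (cap := id).
- move=> eps F e0; have [x [x1 xF]] := unit_perp Hdot Hinf F.
  by exists x; split=> //; rewrite nrm0 ltW.
- exact: ltr01.
- by exists k.
- by exists e.
Qed.

(** The coordinates of the adjoint at [y] in an orthonormal basis are the
    [<y, T e_m>]; testing [T] on their partial sums shows that they are square
    summable. *)
Lemma adjoint_exists (T : {linear H -> H}) (K : R) : bounded_by K T ->
  exists S : {linear H -> H}, bounded_by `|K| S /\ adjoint_of dot T S.
Proof.
move=> TK; have [e eb] := orthonormal_basis_exists.
have cK y M : \sum_(0 <= m < M) nrm (dot y (T (e m))) ^+ 2 <= (`|K| * nrm y) ^+ 2.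
  pose s := \sum_(0 <= m < M) dot y (T (e m)) *: e m.
  have eo : {in index_iota 0 M &, forall i j, dot (e i) (e j) = (i == j)%:R}.
    by move=> i j _ _; exact: eb.1.
  have ss : nrm s ^+ 2 = \sum_(0 <= m < M) nrm (dot y (T (e m))) ^+ 2.
    exact: (family_nrm Hdot (iota_uniq _ _) eo).
  have ys : dot y (T s) = (nrm s ^+ 2)%:C.
    rewrite ss /s (linear_sum T) dot_sumr rmorph_sum /=; apply: eq_bigr => i _.
    by rewrite (linearZ_LR T) dotZr mulrC nrm_sqr.
  rewrite -ss ler_sqr ?nnegrE ?mulr_ge0 ?nrm_ge0//.
  have : nrm s ^+ 2 <= `|K| * nrm y * nrm s.
    have -> : nrm s ^+ 2 = nrm (dot y (T s)) by rewrite ys nrm_real ger0_norm ?sqr_ge0.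
    rewrite (le_trans (CauchySchwarz_nrm Hdot _ _))// mulrAC mulrC.
    rewrite ler_wpM2r ?nrm_ge0// (le_trans (TK s))// ler_wpM2r ?nrm_ge0//.
    exact: ler_norm.
  have [->|/eqP/nrm_gt0 s0] := eqVneq s 0.
    by rewrite nrm0 mulr_ge0 ?nrm_ge0.
  by rewrite expr2 ler_pM2r.
have /choice[S SP] y : exists l,
    lim_to (fun M => \sum_(0 <= m < M) dot y (T (e m)) *: e m) l.
  exact: (orthonormal_series Hdot eb.1 (cK y)).
have Sadj x y : dot (T x) y = dot x (S y).
  have Tx : lim_to (fun M => T (\sum_(0 <= m < M) dot x (e m) *: e m)) (T x).
    apply: (lim_to_lip (K := K)) (expansion Hdot eb x) => u v.
    by rewrite -(raddfB T); exact: TK.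
  apply: (lim_to_uniq (lim_to_dotl Hdot y Tx)).
  apply: lim_to_ext (lim_to_dotl Hdot (S y) (expansion Hdot eb x)) => M.
  rewrite (linear_sum T) !dot_suml; apply: eq_bigr => m _.
  rewrite (linearZ_LR T) !dotZl (dotC dot _ (S y)).
  by rewrite (orthonormal_series_coef Hdot m eb.1 (SP y)) -dotC.
have SC x y : dot (S x) y = dot x (T y) by rewrite dotC -Sadj -dotC.
have Sl : linear S.
  by move=> a u v; apply: (dot_ext Hdot) => y; rewrite !(SC, dotDl, dotZl).
pose S' : {linear H -> H} := HB.pack S (GRing.isLinear.Build _ _ _ _ S Sl).
exists S'; split=> // x; rewrite -[X in nrm X]/(S x).
apply: (lim_to_sqr_le (SP x)) => [|M]; first by rewrite mulr_ge0 ?nrm_ge0.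
have eo : {in index_iota 0 M &, forall i j, dot (e i) (e j) = (i == j)%:R}.
  by move=> i j _ _; exact: eb.1.
by rewrite (family_nrm Hdot (iota_uniq _ _) eo); exact: cK.
Qed.

Lemma cartesian_decomposition (T : {linear H -> H}) (K : R) : bounded_by K T ->
  exists (A B : {linear H -> H}) (KA KB : R),
    [/\ selfadj dot A, selfadj dot B, bounded_by KA A, bounded_by KB B &
        forall x, T x = A x + 'i%C *: B x].
Proof.
move=> TK; have [S [SK TS]] := adjoint_exists TK.
have ST x y : dot (S x) y = dot x (T y) by rewrite dotC -TS -dotC.
have ci : Num.conj ('i%C : R[i]) = - 'i%C by rewrite complexiE conjCi.
have ii : 'i%C * 'i%C = -1 :> R[i] by rewrite -expr2 sqr_i.
have As : selfadj dot (fun x => 2^-1%:C *: (T x + S x)).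
  apply: selfadjZ => x y; rewrite dotDl dotDr TS ST addrC.
  by [].
have Bs : selfadj dot (fun x => 2^-1%:C *: ('i%C *: (S x - T x))).
  apply: selfadjZ => x y.
  by rewrite dotZl dotZr ci !(dotDl, dotDr, dotNl, dotNr) TS ST; ring.
have [A AE] := selfadj_linear Hdot As; have [B BE] := selfadj_linear Hdot Bs.
exists A, B, (`|2^-1| * (K + `|K|)), (`|2^-1| * (nrm ('i%C : R[i]) * (`|K| + K))).
split.
- by move=> x y; rewrite !AE As.
- by move=> x y; rewrite !BE Bs.
- by move=> x; rewrite AE; exact: (bounded_byZ 2^-1 (bounded_byD TK SK) x).
- move=> x; rewrite BE nrmZr -mulrA ler_wpM2l// nrmZ -mulrA ler_wpM2l ?nrm_ge0//.
  exact: (bounded_byD SK (bounded_byN TK) x).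
- move=> x; rewrite AE BE.
  have half : 2^-1%:C + 2^-1%:C = 1 :> R[i].
    by rewrite -rmorphD/= (_ : 2^-1 + 2^-1 = 1)//; field.
  have -> : 'i%C *: (2^-1%:C *: ('i%C *: (S x - T x))) =
      ('i%C * 'i%C) *: (2^-1%:C *: (S x - T x)) by dot_ring Hdot.
  by rewrite -[T x in LHS]scale1r -half ii; dot_ring Hdot.
Qed.

End Adjoint.

Theorem corollary3p2 (R : realType) (H : completeNormedModType R[i])
    (dot : {dot H for Num.conj}) (Hdot : induces_norm dot)
    (Hsep : separable H) (Hinf : infinite_dimensional H)
    (T : {linear H -> H}) (HT : bounded_operator T) :
  exists (c : 'I_8 -> R[i]) (P : 'I_8 -> {linear H -> H}),
    (forall i : 'I_8, orthoprojection dot (P i)) /\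
    (forall x : H, T x = \sum_(i < 8) c i *: P i x).
Proof.
have [K TK] := bounded_operator_real HT.
have [A [B [KA [KB [As Bs AK BK TE]]]]] := cartesian_decomposition Hdot Hsep Hinf TK.
have [a1 [a2 [a3 [a4 [P1 [P2 [P3 [P4 [p1 p2 p3 p4 AE]]]]]]]]] :=
  selfadjoint_four_projections Hdot Hsep Hinf As AK.
have [b1 [b2 [b3 [b4 [Q1 [Q2 [Q3 [Q4 [q1 q2 q3 q4 BE]]]]]]]]] :=
  selfadjoint_four_projections Hdot Hsep Hinf Bs BK.
exists (fun i => [:: a1%:C; a2%:C; a3%:C; a4%:C; 'i%C * b1%:C; 'i%C * b2%:C;
                     'i%C * b3%:C; 'i%C * b4%:C]`_i).
exists (fun i => nth P1 [:: P1; P2; P3; P4; Q1; Q2; Q3; Q4] i); split.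
  by case=> [[|[|[|[|[|[|[|[|]]]]]]]]].
move=> x; rewrite !big_ord_recl big_ord0 /= TE AE BE addr0.
by rewrite !scalerDr !scalerA !addrA.
Qed.
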